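(* Every semi-algebraic set $X\subset\mathbb{R}^n$ is nearly radial at each of its points.
   Context: A set is semi-algebraic if it is a finite union of sets defined by finitely many polynomial equalities and inequalities. The tangent cone is $T_X(x)=\{\lim t_r^{-1}(x_r-x):t_r\downarrow0,\ x_r\to x,\ x_r\in X\}$. $X$ is nearly radial at $\bar x\in X$ if $\operatorname{dist}\big(\tfrac{\bar x-x}{\|\bar x-x\|},T_X(x)\big)\to0$ as $x\to\bar x$, $x\in X$, $x\ne\bar x$ (equivalently $\operatorname{dist}(\bar x,x+T_X(x))=o(\|x-\bar x\|)$). *)

(* Defs.v *)
From Stdlib Require Import Reals List Arith.
Open Scope R_scope.

Definition idx (n : nat) := {i : nat | (i < n)%nat}.
Definition vec (n : nat) := idx n -> R.

Definition coord {n : nat} (x : vec n) (i : nat) : R :=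
  match lt_dec i n with
  | left h => x (exist _ i h)
  | right _ => 0
  end.

Definition vadd {n} (x y : vec n) : vec n := fun i => x i + y i.
Definition vsub {n} (x y : vec n) : vec n := fun i => x i - y i.
Definition vscale {n} (a : R) (x : vec n) : vec n := fun i => a * x i.

Definition vnorm {n : nat} (x : vec n) : R :=
  sqrt (fold_right Rplus 0 (map (fun i => coord x i ^ 2) (seq 0 n))).

Inductive poly (n : nat) : Type :=
| PVar : forall i : nat, (i < n)%nat -> poly n
| PConst : R -> poly n
| PAdd : poly n -> poly n -> poly n
| PMul : poly n -> poly n -> poly n.
Arguments PVar {n} i _.
Arguments PConst {n} _.
Arguments PAdd {n} _ _.
Arguments PMul {n} _ _.

Fixpoint peval {n : nat} (p : poly n) (x : vec n) : R :=
  match p with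
  | PVar i h => x (exist _ i h)
  | PConst c => c
  | PAdd p q => peval p x + peval q x
  | PMul p q => peval p x * peval q x
  end.

Definition basic_sa {n : nat} (eqs ineqs : list (poly n)) (x : vec n) : Prop :=
  (forall f, In f eqs -> peval f x = 0) /\ (forall g, In g ineqs -> peval g x > 0).

Definition semialgebraic {n : nat} (X : vec n -> Prop) : Prop :=
  exists L : list (list (poly n) * list (poly n)),
    forall x, X x <-> exists c, In c L /\ basic_sa (fst c) (snd c) x.

Definition vcv {n : nat} (u : nat -> vec n) (l : vec n) : Prop :=
  Un_cv (fun r => vnorm (vsub (u r) l)) 0.

Definition tangent_cone {n : nat} (X : vec n -> Prop) (x : vec n) (v : vec n) : Prop :=
  exists (t : nat -> R) (xs : nat -> vec n),
    (forall r, 0 < t r) /\ Un_cv t 0 /\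
    (forall r, X (xs r)) /\ vcv xs x /\
    vcv (fun r => vscale (/ t r) (vsub (xs r) x)) v.

Definition dist_lt {n : nat} (p : vec n) (S : vec n -> Prop) (eps : R) : Prop :=
  exists w, S w /\ vnorm (vsub p w) < eps.

Definition nearly_radial {n : nat} (X : vec n -> Prop) (xb : vec n) : Prop :=
  forall eps, 0 < eps -> exists delta, 0 < delta /\
    forall x, X x -> x <> xb -> vnorm (vsub x xb) < delta ->
      dist_lt (vscale (/ vnorm (vsub xb x)) (vsub xb x)) (tangent_cone X x) eps.

(* Main.v *)
From Stdlib Require Import Reals Lra Lia Classical ClassicalEpsilon FunctionalExtensionality.
From Stdlib Require Import List Arith.
From mathcomp Require all_boot all_order all_algebra.
From mathcomp Require ordered_qelim qe_rcf Rstruct.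
Require Import Defs.
Open Scope R_scope.

(** If the property failed at [xb], the points [x = xb + t w], [|w| = 1], from
    which no direction within [eps] of [- w] is tangent to [X] would accumulate
    at [xb]. By quantifier elimination they form a semi-algebraic set, so
    definable choice gives a semi-algebraic curve [w t] of such points, for all
    small [t > 0]. The bounded functions [w_i] have limits [c_i] at [0+], hence
    [k_i t = t (w_i t - c_i)] is [o(t)], and a semi-algebraic [o(t)] has backward
    difference quotients at [t] that tend to [0] with [t]. The secants of the
    curve from [t] to [t - s] are therefore almost parallel to [- c], that is to
    [- w t]: a contradiction. No smoothness of the curve is needed; the only
    consequence of quantifier elimination used besides closure properties is that
    a definable property of [t] is eventually true or eventually false at [0+]. *)

(** * Quantifier elimination *)

(** The claim on difference quotients carries the weight. If those of [k] exceeded [eps] at every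
    small [t], the function [k t - eps * t] would grow on the left of each small point. Without
    continuity this does not yet make it increasing, as it could drop just to the right of a point;
    a Baire argument, available because definable sets have trivial right germs, excludes such drops
    near 0. An increasing function that tends to 0 at 0+ cannot be negative there, whereas
    [k t - eps * t] is negative when [k] is [o(t)]. Two encodings keep the argument first-order. The
    tangent cone, defined by sequences, is replaced by [approach], a condition at a single scale;
    and points are indexed by their distance to [xb], so that closeness to [xb] becomes a germ in
    one real variable. Directions are compared coordinatewise, and the return to the Euclidean norm
    costs a factor depending on [n]. *)

Definition scons {A : Type} (x : A) (e : nat -> A) (i : nat) : A :=
  match i with 0%nat => x | S j => e j end.

Module QE.
Import all_boot all_order all_algebra ordered_qelim.
Import Order.TTheory GRing.Theory Num.Theory.
Set Implicit Arguments.
Unset Strict Implicit.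
Unset Printing Implicit Defensive.
Local Open Scope ring_scope.

Section RealClosed.
Variable F : rcfType.
Implicit Types (e : nat -> F) (t : GRing.term F) (f : ord.formula F).

Fixpoint teval e t : F :=
  match t with
  | GRing.Var i => e i
  | GRing.Const c => c
  | GRing.NatConst n => n%:R
  | GRing.Add a b => teval e a + teval e b
  | GRing.Opp a => - teval e a
  | GRing.NatMul a n => teval e a *+ n
  | GRing.Mul a b => teval e a * teval e b
  | GRing.Inv a => (teval e a)^-1
  | GRing.Exp a n => teval e a ^+ n
  end.

(** Environments are total functions, not finite sequences, so that shifting and renaming variables
    involve no lengths. The default [False] covers quantifiers and [Unit], which [qfr] excludes. *)
Fixpoint feval e f : Prop :=
  match f with
  | ord.Bool b => b
  | ord.Equal a b => teval e a = teval e b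
  | ord.Lt a b => teval e a < teval e b
  | ord.Le a b => teval e a <= teval e b
  | ord.And f g => feval e f /\ feval e g
  | ord.Or f g => feval e f \/ feval e g
  | ord.Implies f g => feval e f -> feval e g
  | ord.Not f => ~ feval e f
  | _ => False
  end.

Fixpoint tsub (r : nat -> GRing.term F) t : GRing.term F :=
  match t with
  | GRing.Var i => r i
  | GRing.Add a b => GRing.Add (tsub r a) (tsub r b)
  | GRing.Opp a => GRing.Opp (tsub r a)
  | GRing.NatMul a n => GRing.NatMul (tsub r a) n
  | GRing.Mul a b => GRing.Mul (tsub r a) (tsub r b)
  | GRing.Inv a => GRing.Inv (tsub r a)
  | GRing.Exp a n => GRing.Exp (tsub r a) n
  | _ => t
  end.

Fixpoint fsub (r : nat -> GRing.term F) f : ord.formula F :=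
  match f with
  | ord.Equal a b => ord.Equal (tsub r a) (tsub r b)
  | ord.Lt a b => ord.Lt (tsub r a) (tsub r b)
  | ord.Le a b => ord.Le (tsub r a) (tsub r b)
  | ord.And f g => ord.And (fsub r f) (fsub r g)
  | ord.Or f g => ord.Or (fsub r f) (fsub r g)
  | ord.Implies f g => ord.Implies (fsub r f) (fsub r g)
  | ord.Not f => ord.Not (fsub r f)
  | _ => f
  end.

Definition qfr f := ord.qf_form f && ord.rformula f.

Lemma teval_tsub r e t : teval e (tsub r t) = teval (fun i => teval e (r i)) t.
Proof.
by elim: t => //= [a -> b -> | a -> | a -> n | a -> b -> | a -> | a -> n].
Qed.

Lemma feval_fsub r e f : feval e (fsub r f) <-> feval (fun i => teval e (r i)) f.
Proof.
elim: f => /= *; rewrite ?teval_tsub; tauto.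
Qed.

Lemma rterm_tsub r t : (forall i, GRing.rterm (r i)) -> GRing.rterm t ->
  GRing.rterm (tsub r t).
Proof.
move=> rr; elim: t => //= [a IHa b IHb|a IHa b IHb] /andP[ra rb];
  by rewrite IHa ?IHb.
Qed.

Lemma qfr_fsub r f : (forall i, GRing.rterm (r i)) -> qfr f -> qfr (fsub r f).
Proof.
rewrite /qfr => rr; elim: f => //= [a b|a b|a b|f1 IH1 f2 IH2|f1 IH1 f2 IH2|f1 IH1 f2 IH2];
  try by case/andP=> ra rb; rewrite !rterm_tsub.
all: case/andP=> /andP[q1 q2] /andP[r1 r2].
all: have /andP[-> ->] : ord.qf_form (fsub r f1) && ord.rformula (fsub r f1)
       by apply: IH1; rewrite q1.
all: by have /andP[-> ->] : ord.qf_form (fsub r f2) && ord.rformula (fsub r f2)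
       by apply: IH2; rewrite q2.
Qed.

Fixpoint fub f : nat :=
  match f with
  | ord.Equal a b | ord.Lt a b | ord.Le a b => maxn (GRing.ub_var a) (GRing.ub_var b)
  | ord.And f g | ord.Or f g | ord.Implies f g => maxn (fub f) (fub g)
  | ord.Not f => fub f
  | _ => 0%N
  end.

Lemma teval_agree e e' t :
  (forall i, (i < GRing.ub_var t)%N -> e i = e' i) -> teval e t = teval e' t.
Proof.
elim: t => //= [n H|a IHa b IHb H|a IHa H|a IHa n H|a IHa b IHb H|a IHa H|a IHa n H].
- exact: H.
- by rewrite IHa ?IHb // => i Hi; apply: H; rewrite leq_max Hi ?orbT.
- by rewrite IHa.
- by rewrite IHa.
- by rewrite IHa ?IHb // => i Hi; apply: H; rewrite leq_max Hi ?orbT.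
- by rewrite IHa.
- by rewrite IHa.
Qed.

Lemma feval_agree e e' f :
  (forall i, (i < fub f)%N -> e i = e' i) -> feval e f <-> feval e' f.
Proof.
have split_max (m n : nat) : (forall i, (i < maxn m n)%N -> e i = e' i) ->
    (forall i, (i < m)%N -> e i = e' i) /\ (forall i, (i < n)%N -> e i = e' i).
  by move=> H; split=> i Hi; apply: H; rewrite leq_max Hi ?orbT.
elim: f => //=; first 3 last.
- by move=> f1 IH1 f2 IH2 /split_max[/IH1 ? /IH2 ?]; tauto.
- by move=> f1 IH1 f2 IH2 /split_max[/IH1 ? /IH2 ?]; tauto.
- by move=> f1 IH1 f2 IH2 /split_max[/IH1 ? /IH2 ?]; tauto.
- by move=> f1 IH1 /IH1 ?; tauto.
all: by move=> a b /split_max[Ha Hb]; rewrite (teval_agree Ha) (teval_agree Hb).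
Qed.

Lemma eval_teval (s : seq F) t : GRing.eval s t = teval (nth 0 s) t.
Proof. by elim: t => //= [a -> b ->|a ->|a -> n|a -> b ->|a ->|a -> n]. Qed.

Lemma holds_feval (s : seq F) f : ord.qf_form f -> ord.rformula f ->
  ord.holds s f <-> feval (nth 0 s) f.
Proof.
elim: f => //= [a b|a b|a b|f1 IH1 f2 IH2|f1 IH1 f2 IH2|f1 IH1 f2 IH2|f1 IH1];
  rewrite ?eval_teval //.
all: try by case/andP=> q1 q2 /andP[r1 r2]; rewrite IH1 // IH2.
by move=> q r; rewrite IH1.
Qed.

Definition qf_definable (P : (nat -> F) -> Prop) : Prop :=
  exists2 f, qfr f & forall e, P e <-> feval e f.

Definition term_fun (g : (nat -> F) -> F) : Prop :=
  exists2 t, GRing.rterm t & forall e, g e = teval e t.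

(** Quantifier elimination enters here only. It is stated for finite sequences, missing entries
    being read as 0; since [f] mentions no variable from [fub f] on, the environment can be cut at
    that length. *)
Lemma qf_definable_exists (P : (nat -> F) -> Prop) : qf_definable P ->
  qf_definable (fun e => exists x, P (scons x e)).
Proof.
case=> f qf fP; set N := fub f.
have /andP[q r] := qf.
pose g := ord.quantifier_elim (fun i bc => qe_rcf.qfr_to_formula (@qe_rcf.wproj F i bc)) (ord.Exists 0 f).
have qg : qfr g by apply: ord.quantifier_elim_wf => //; exact: qe_rcf.wf_QE_wproj.
have gP s : feval (nth 0 s) g <-> exists x, ord.holds (set_nth 0 s 0 x) f.
  have /andP[qg' rg'] := qg.
  rewrite -holds_feval // (rwP (ord.qf_evalP _ qg')).
  have := @ord.quantifier_elim_rformP F _ (@qe_rcf.wf_QE_wproj F) (@qe_rcf.valid_QE_wproj F) s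
    (ord.Exists 0 f) r.
  by move=> /rwP <-.
(* Slot 0 is the one overwritten by the eliminated quantifier, so any value may stand there. The
   other slots move down by one, and those past the cut become 0 to match the truncated sequence. *)
pose rho i : GRing.term F :=
  if i is j.+1 then (if (j < N)%N then GRing.Var F j else GRing.Const 0) else GRing.Const 0.
exists (fsub rho g); first by apply: qfr_fsub => // -[|i] //=; case: ifP.
move=> e; rewrite feval_fsub.
rewrite (@feval_agree _ (nth 0 (0 :: mkseq e N))); last first.
  move=> [|i] _ //=; case: ifP => /= iN; first by rewrite nth_mkseq.
  by rewrite nth_default // size_mkseq leqNgt iN.
rewrite gP; split=> -[x Hx]; exists x; move: Hx; rewrite fP /= holds_feval //;
  apply feval_agree => -[|i] //= iN; rewrite nth_mkseq //; exact: ltn_trans iN.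
Qed.

Lemma qf_definable_subst (P : (nat -> F) -> Prop) (s : nat -> (nat -> F) -> F) :
  qf_definable P -> (forall i, term_fun (s i)) -> qf_definable (fun e => P (fun i => s i e)).
Proof.
case=> f qf fP Ts.
have c i : { t | GRing.rterm t /\ forall e, s i e = teval e t }.
  by apply: constructive_indefinite_description; case: (Ts i) => t; exists t.
exists (fsub (fun i => sval (c i)) f).
  by apply: qfr_fsub => // i; case: (svalP (c i)).
move=> e; rewrite feval_fsub fP.
by apply: feval_agree => i _; case: (svalP (c i)) => _ ->.
Qed.

Lemma qf_definable_and P Q : qf_definable P -> qf_definable Q -> qf_definable (fun e => P e /\ Q e).
Proof.
case=> f /andP[qf rf] fP [g /andP[qg rg] gP]; exists (ord.And f g).
  by rewrite /qfr /= qf qg rf rg.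
by move=> e; rewrite fP gP.
Qed.

Lemma qf_definable_not P : qf_definable P -> qf_definable (fun e => ~ P e).
Proof. by case=> f qf fP; exists (ord.Not f) => // e; rewrite fP. Qed.

Lemma qf_definable_lt a b : term_fun a -> term_fun b -> qf_definable (fun e => a e < b e).
Proof.
case=> s rs sa [t rt tb]; exists (ord.Lt s t); first by rewrite /qfr /= rs rt.
by move=> e; rewrite sa tb.
Qed.

Lemma qf_definable_eq a b : term_fun a -> term_fun b -> qf_definable (fun e => a e = b e).
Proof.
case=> s rs sa [t rt tb]; exists (ord.Equal s t); first by rewrite /qfr /= rs rt.
by move=> e; rewrite sa tb.
Qed.

Lemma term_fun_var i : term_fun (fun e => e i).
Proof. by exists (GRing.Var F i). Qed.

Lemma term_fun_const c : term_fun (fun _ => c).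
Proof. by exists (GRing.Const c). Qed.

Lemma term_fun_add a b : term_fun a -> term_fun b -> term_fun (fun e => a e + b e).
Proof.
case=> s rs sa [t rt tb]; exists (GRing.Add s t); first by rewrite /= rs.
by move=> e; rewrite sa tb.
Qed.

Lemma term_fun_mul a b : term_fun a -> term_fun b -> term_fun (fun e => a e * b e).
Proof.
case=> s rs sa [t rt tb]; exists (GRing.Mul s t); first by rewrite /= rs.
by move=> e; rewrite sa tb.
Qed.

(** * Signs of polynomials and germs at 0+ *)

Definition germ (P : F -> Prop) := exists2 d, 0 < d & forall x, 0 < x < d -> P x.

Lemma germ_and P Q : germ P -> germ Q -> germ (fun x => P x /\ Q x).
Proof.
case=> d d0 dP [c c0 cQ]; exists (Num.min d c); first by rewrite lt_min d0.
by move=> x /andP[x0]; rewrite lt_min => /andP[xd xc]; split; [apply: dP|apply: cQ]; rewrite x0.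
Qed.

Lemma germ_imp (P Q : F -> Prop) : (forall x, 0 < x -> P x -> Q x) -> germ P -> germ Q.
Proof.
move=> PQ [d d0 dP]; exists d => // x xd; apply: PQ (dP x xd); by case/andP: xd.
Qed.

(** Horner induction: in [p.[x] * x + c] a nonzero [c] dominates, because [p.[x] * x] tends to 0;
    for [c = 0] the sign is that of [p.[x]], as [x] is positive. *)
Lemma poly_germ (p : {poly F}) :
  [\/ germ (fun x => p.[x] < 0), germ (fun x => p.[x] = 0) | germ (fun x => 0 < p.[x])].
Proof.
elim/poly_ind: p => [|p c IH].
  by constructor 2; exists 1 => // x _; rewrite horner0.
have E x : (p * 'X + c%:P).[x] = p.[x] * x + c by rewrite !hornerE.
have [->|c0] := eqVneq c 0.
  case: IH => H; [constructor 1|constructor 2|constructor 3]; move: H;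
    apply: germ_imp => x x0; rewrite !hornerE.
  - by rewrite pmulr_llt0.
  - by move=> ->; rewrite mul0r.
  - by rewrite pmulr_lgt0.
have [M HM] := poly_disk_bound p 1.
have M0 : 0 <= M by apply: le_trans (normr_ge0 _) (HM 0 _); rewrite normr0.
have small : germ (fun x => `|p.[x] * x| < `|c|).
  exists (Num.min 1 (`|c| / (M + 1))).
    by rewrite lt_min ltr01 divr_gt0 ?normr_gt0 // ltr_wpDl.
  move=> x /andP[x0]; rewrite lt_min => /andP[x1]; rewrite ltr_pdivlMr ?ltr_wpDl // => xc.
  rewrite normrM (gtr0_norm x0) mulrC.
  apply: le_lt_trans xc; apply: ler_wpM2l; first exact: ltW.
  apply: le_trans (HM x _) _; first by rewrite gtr0_norm // ltW.
  by rewrite lerDl.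
move: c0; rewrite neq_lt => /orP[c0|c0]; [constructor 1|constructor 3]; move: small;
  apply: germ_imp => x _; rewrite E.
- by rewrite (ltr0_norm c0) ltr_norml opprK => /andP[_]; rewrite -subr_lt0 opprK.
- by rewrite (gtr0_norm c0) ltr_norml => /andP[]; rewrite -subr_gt0 opprK.
Qed.

Lemma term_poly e t : GRing.rterm t ->
  exists p : {poly F}, forall x, teval (scons x e) t = p.[x].
Proof.
elim: t => //= [[|i]|c|n|a IHa b IHb|a IHa|a IHa n|a IHa b IHb|a IHa n].
- by exists 'X => x; rewrite hornerX.
- by exists (e i)%:P => x; rewrite hornerC.
- by exists c%:P => x; rewrite hornerC.
- by exists n%:R%:P => x; rewrite hornerC.
- case/andP=> /IHa[p Hp] /IHb[q Hq]; exists (p + q) => x; by rewrite hornerD Hp Hq.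
- case/IHa=> p Hp; exists (- p) => x; by rewrite hornerN Hp.
- case/IHa=> p Hp; exists (p *+ n) => x; by rewrite hornerMn Hp.
- case/andP=> /IHa[p Hp] /IHb[q Hq]; exists (p * q) => x; by rewrite hornerM Hp Hq.
- case/IHa=> p Hp; exists (p ^+ n) => x; by rewrite horner_exp Hp.
Qed.

(** Freezing all variables but the first turns each atom into a sign condition on a polynomial in
    [x], which settles near 0+; the alternative then passes through the connectives. *)
Lemma qf_definable_germ (P : (nat -> F) -> Prop) e : qf_definable P ->
  germ (fun x => P (scons x e)) \/ germ (fun x => ~ P (scons x e)).
Proof.
case=> f qf fP.
suff H : germ (fun x => feval (scons x e) f) \/ germ (fun x => ~ feval (scons x e) f).
  by case: H => H; [left|right]; move: H; apply: germ_imp => x _; rewrite fP.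
have cmp a b : GRing.rterm a && GRing.rterm b ->
   [\/ germ (fun x => teval (scons x e) a < teval (scons x e) b),
       germ (fun x => teval (scons x e) a = teval (scons x e) b) |
       germ (fun x => teval (scons x e) b < teval (scons x e) a)].
  case/andP=> /(term_poly e)[p Hp] /(term_poly e)[q Hq].
  case: (poly_germ (p - q)) => H; [constructor 1|constructor 2|constructor 3];
    move: H; apply: germ_imp => x _; rewrite Hp Hq !hornerE.
  - by rewrite subr_lt0.
  - by move/eqP; rewrite subr_eq0 => /eqP.
  - by rewrite subr_gt0.
case/andP: qf; elim: f {P fP} => //=.
- by move=> [] _ _; [left|right]; exists 1 => //.
- move=> a b _ /cmp[] H; [right|left|right] => //; move: H; apply: germ_imp => x _.
  + by move=> + E; rewrite E ltxx.
  + by move=> + E; rewrite E ltxx.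
- move=> a b _ /cmp[] H; [left|right|right] => //; move: H; apply: germ_imp => x _.
  + by move=> ->; rewrite ltxx.
  + by move=> H /(lt_trans H); rewrite ltxx.
- move=> a b _ /cmp[] H; [left|left|right] => //; move: H; apply: germ_imp => x _.
  + exact: ltW.
  + by move=> ->.
  + by move=> H /(lt_le_trans H); rewrite ltxx.
- move=> f1 IH1 f2 IH2 /andP[q1 q2] /andP[r1 r2].
  case: (IH1 q1 r1) => H1; last by right; move: H1; apply: germ_imp => x _; tauto.
  case: (IH2 q2 r2) => H2; last by right; move: H2; apply: germ_imp => x _; tauto.
  by left; exact: germ_and.
- move=> f1 IH1 f2 IH2 /andP[q1 q2] /andP[r1 r2].
  case: (IH1 q1 r1) => H1; first by left; move: H1; apply: germ_imp => x _; tauto.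
  case: (IH2 q2 r2) => H2; first by left; move: H2; apply: germ_imp => x _; tauto.
  by right; move: (germ_and H1 H2); apply: germ_imp => x _; tauto.
- move=> f1 IH1 f2 IH2 /andP[q1 q2] /andP[r1 r2].
  case: (IH1 q1 r1) => H1; last by left; move: H1; apply: germ_imp => x _; tauto.
  case: (IH2 q2 r2) => H2; first by left; move: H2; apply: germ_imp => x _; tauto.
  by right; move: (germ_and H1 H2); apply: germ_imp => x _; tauto.
- move=> f1 IH1 q r; case: (IH1 q r) => H; [right|left] => //.
  by move: H; apply: germ_imp => x _; tauto.
Qed.
End RealClosed.
Section DefinablePredicates.
Import Rstruct.

Lemma term_fun_rename (F : rcfType) (g : (nat -> F) -> F) (r : nat -> nat) :
  term_fun g -> term_fun (fun e => g (fun i => e (r i))).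
Proof.
case=> t rt gt; exists (tsub (fun i => GRing.Var F (r i)) t).
  exact: rterm_tsub.
by move=> e; rewrite teval_tsub gt.
Qed.

Lemma qf_definable_support (F : rcfType) (P : (nat -> F) -> Prop) : qf_definable P ->
  exists n : nat, forall e e', (forall i, (i < n)%coq_nat -> e i = e' i) -> P e <-> P e'.
Proof.
case=> f _ fP; exists (fub f) => e e' H; rewrite !fP.
by apply: feval_agree => i Hi; apply: H; apply/ssrnat.ltP.
Qed.

Definition definable (P : (nat -> R) -> Prop) : Prop := qf_definable P.
Definition polynomial (g : (nat -> R) -> R) : Prop := term_fun g.

Lemma polynomial_const c : polynomial (fun _ => c).
Proof. exact: term_fun_const. Qed.

Lemma definable_lt_term a b : polynomial a -> polynomial b ->
  definable (fun e => Rlt (a e) (b e)).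
Proof.
move=> Ta Tb; case: (qf_definable_lt Ta Tb) => f qf fP; exists f => // e.
by rewrite -fP; split=> /RltP.
Qed.

Lemma definable_germ P e : definable P ->
  exists d, Rlt R0 d /\
    ((forall x, Rlt R0 x -> Rlt x d -> P (scons x e)) \/
     (forall x, Rlt R0 x -> Rlt x d -> ~ P (scons x e))).
Proof.
case/(qf_definable_germ e) => -[d /RltP d0 dP]; exists d; split=> //; [left|right] => x /RltP x0 /RltP xd;
  by apply: dP; rewrite x0.
Qed.
End DefinablePredicates.
End QE.

Set Bullet Behavior "Strict Subproofs".

(** * Definable predicates and functions *)

Definition shift {A : Type} (e : nat -> A) (i : nat) : A := e (S i).

Definition definable := QE.definable.

(* Functions [nat -> R] serve as environments; [definable_fun] says that the
   graph of a function of the environment is definable, the value being put in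
   front. *)
Definition definable_fun (g : (nat -> R) -> R) : Prop :=
  definable (fun e => e 0%nat = g (shift e)).

Lemma definable_ext (P Q : (nat -> R) -> Prop) :
  (forall e, P e <-> Q e) -> definable P -> definable Q.
Proof.
  intros H [f qf fP]. exists f; [exact qf|]. intros e. rewrite <- (H e). apply fP.
Qed.

Lemma definable_rename (P : (nat -> R) -> Prop) (r : nat -> nat) :
  definable P -> definable (fun e => P (fun i => e (r i))).
Proof.
  intros H. apply (QE.qf_definable_subst (s := fun i e => e (r i)) H).
  intros i. apply QE.term_fun_var.
Qed.

Lemma definable_and P Q : definable P -> definable Q -> definable (fun e => P e /\ Q e).
Proof. apply QE.qf_definable_and. Qed.

Lemma definable_not P : definable P -> definable (fun e => ~ P e).
Proof. apply QE.qf_definable_not. Qed.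

Lemma definable_or P Q : definable P -> definable Q -> definable (fun e => P e \/ Q e).
Proof.
  intros HP HQ.
  apply definable_ext with (fun e => ~ (~ P e /\ ~ Q e)).
  - intros e. destruct (classic (P e)), (classic (Q e)); tauto.
  - apply definable_not, definable_and; apply definable_not; assumption.
Qed.

Lemma definable_imp P Q : definable P -> definable Q -> definable (fun e => P e -> Q e).
Proof.
  intros HP HQ.
  apply definable_ext with (fun e => ~ P e \/ Q e).
  - intros e. destruct (classic (P e)); tauto.
  - apply definable_or; [apply definable_not|]; assumption.
Qed.

Lemma definable_exists (Q : R -> (nat -> R) -> Prop) :
  definable (fun e => Q (e 0%nat) (shift e)) -> definable (fun e => exists x, Q x e).
Proof. intros H. exact (QE.qf_definable_exists H). Qed.

Lemma definable_forall (Q : R -> (nat -> R) -> Prop) :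
  definable (fun e => Q (e 0%nat) (shift e)) -> definable (fun e => forall x, Q x e).
Proof.
  intros H.
  apply definable_ext with (fun e => ~ exists x, ~ Q x e).
  - intros e. split; [|firstorder].
    intros K x. apply NNPP. intros N. apply K. exists x. exact N.
  - apply definable_not, (definable_exists (fun x e => ~ Q x e)), definable_not, H.
Qed.

Lemma definable_fun_poly g : QE.polynomial g -> definable_fun g.
Proof.
  intros H. apply (QE.qf_definable_eq (QE.term_fun_var _ 0) (QE.term_fun_rename S H)).
Qed.

Lemma definable_fun_rename g (r : nat -> nat) :
  definable_fun g -> definable_fun (fun e => g (fun i => e (r i))).
Proof.
  intros H.
  exact (definable_rename (fun e => e 0%nat = g (shift e))
    (fun i => match i with O => O | S j => S (r j) end) H).
Qed.

(** The [s i] have definable graphs but need not be terms, so each is brought in by an existential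
    quantifier, one variable at a time. Finitely many rounds suffice, since [P] depends on finitely
    many variables. *)
Lemma definable_subst (P : (nat -> R) -> Prop) (s : nat -> (nat -> R) -> R) :
  definable P -> (forall i, definable_fun (s i)) -> definable (fun e => P (fun i => s i e)).
Proof.
  intros HP Hs.
  (* After [k] rounds the environment lists the first [k] values [s i e] and then the whole of [e]
     from position [k] on: the next substitution still needs [e] unaltered. *)
  assert (A : forall k Q, definable Q ->
    definable (fun e => Q (fun i => if (i <? k)%nat then s i e else e (i - k)%nat))).
  { induction k as [|k IH]; intros Q HQ.
    - apply definable_ext with Q; [|exact HQ].
      intros e. simpl.
      replace (fun i => e (i - 0)%nat) with e; [reflexivity|].
      apply functional_extensionality. intros i. now rewrite Nat.sub_0_r.
    - pose (Q' := fun e' : nat -> R => exists x,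
          x = s k (fun i => e' (k + i)%nat) /\
          Q (fun i => if (i <? k)%nat then e' i else
             match (i - k)%nat with O => x | S j => e' (k + j)%nat end)).
      apply definable_ext with
        (fun e => Q' (fun i => if (i <? k)%nat then s i e else e (i - k)%nat)).
      + intros e.
        assert (E1 : (fun i => if (k + i <? k)%nat then s (k + i)%nat e
                      else e (k + i - k)%nat) = e).
        { apply functional_extensionality. intros i.
          destruct (Nat.ltb_spec (k + i) k); [lia|]. f_equal. lia. }
        unfold Q'. rewrite E1.
        assert (E2 : (fun i => if (i <? k)%nat
            then if (i <? k)%nat then s i e else e (i - k)%nat
            else match (i - k)%nat with O => s k e
                 | S j => if (k + j <? k)%nat then s (k + j)%nat e else e (k + j - k)%nat end)
          = (fun i => if (i <? S k)%nat then s i e else e (i - S k)%nat)).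
        { apply functional_extensionality. intros i.
          destruct (Nat.ltb_spec i k), (Nat.ltb_spec i (S k)); try lia; try reflexivity.
          - assert (i = k) by lia. subst. now rewrite Nat.sub_diag.
          - destruct (i - k)%nat as [|j] eqn:E; [lia|].
            destruct (Nat.ltb_spec (k + j) k); [lia|]. f_equal. lia. }
        rewrite <- E2. split.
        * intros (x & -> & H). exact H.
        * intros H. exists (s k e). split; [reflexivity|exact H].
      + apply IH. unfold Q'.
        apply (definable_exists (fun x e' => x = s k (fun i => e' (k + i)%nat) /\
          Q (fun i => if (i <? k)%nat then e' i else
             match (i - k)%nat with O => x | S j => e' (k + j)%nat end))).
        apply definable_and.
        * exact (definable_fun_rename (s k) (fun i => (k + i)%nat) (Hs k)).
        (* Slot [k] reads the bound [x], which sits in front as variable 0. Slots below [k] shift up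
           by one; slots above it keep their index, the removal of slot [k] cancelling that
           shift. *)
        * pose (r := fun i => if (i <? k)%nat then S i else
             match (i - k)%nat with O => O | S j => S (k + j) end).
          apply definable_ext with (fun e => Q (fun i => e (r i)));
            [|now apply definable_rename].
          intros e. replace (fun i => e (r i)) with
            (fun i => if (i <? k)%nat then shift e i else
             match (i - k)%nat with O => e 0%nat | S j => shift e (k + j)%nat end);
            [reflexivity|].
          apply functional_extensionality. intros i. unfold r, shift.
          destruct (i <? k)%nat; [reflexivity|]. now destruct (i - k)%nat. }
  destruct (QE.qf_definable_support HP) as [n Hn].
  apply definable_ext with (2 := A n P HP).
  intros e. apply Hn. intros i Hi.
  destruct (Nat.ltb_spec i n); [reflexivity|lia].
Qed.

Lemma definable_fun_subst (g : (nat -> R) -> R) (s : nat -> (nat -> R) -> R) :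
  definable_fun g -> (forall i, definable_fun (s i)) ->
  definable_fun (fun e => g (fun i => s i e)).
Proof.
  intros Hg Hs.
  refine (definable_subst (fun e => e 0%nat = g (shift e))
    (fun i => match i with O => fun e => e 0%nat | S j => fun e => s j (shift e) end) Hg _).
  intros [|i].
  - apply definable_fun_poly, QE.term_fun_var.
  - exact (definable_fun_rename (s i) S (Hs i)).
Qed.

Lemma definable_var i : definable_fun (fun e => e i).
Proof. apply definable_fun_poly, QE.term_fun_var. Qed.

Lemma definable_const c : definable_fun (fun _ => c).
Proof. apply definable_fun_poly, QE.polynomial_const. Qed.

Definition pair_env (a b : (nat -> R) -> R) (i : nat) : (nat -> R) -> R :=
  match i with O => a | _ => b end.

Lemma definable_pair_env a b : definable_fun a -> definable_fun b ->
  forall i, definable_fun (pair_env a b i).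
Proof. now intros Ha Hb [|i]. Qed.

Lemma definable_plus a b : definable_fun a -> definable_fun b ->
  definable_fun (fun e => a e + b e).
Proof.
  intros Ha Hb.
  refine (definable_fun_subst (fun e => e 0%nat + e 1%nat) _ _ (definable_pair_env a b Ha Hb)).
  apply definable_fun_poly. exact (QE.term_fun_add (QE.term_fun_var _ 0) (QE.term_fun_var _ 1)).
Qed.

Lemma definable_mult a b : definable_fun a -> definable_fun b ->
  definable_fun (fun e => a e * b e).
Proof.
  intros Ha Hb.
  refine (definable_fun_subst (fun e => e 0%nat * e 1%nat) _ _ (definable_pair_env a b Ha Hb)).
  apply definable_fun_poly. exact (QE.term_fun_mul (QE.term_fun_var _ 0) (QE.term_fun_var _ 1)).
Qed.

Lemma definable_fun_ext f g : (forall e, f e = g e) -> definable_fun f -> definable_fun g.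
Proof. intros H Hf. replace g with f; [exact Hf|]. now apply functional_extensionality. Qed.

Lemma definable_opp a : definable_fun a -> definable_fun (fun e => - a e).
Proof.
  intros Ha. apply definable_fun_ext with (fun e => -1 * a e); [intros; ring|].
  apply definable_mult; [apply definable_const|exact Ha].
Qed.

Lemma definable_minus a b : definable_fun a -> definable_fun b ->
  definable_fun (fun e => a e - b e).
Proof. intros Ha Hb. apply definable_plus; [exact Ha|now apply definable_opp]. Qed.

Lemma definable_rel (S : R -> R -> Prop) a b :
  definable (fun e => S (e 0%nat) (e 1%nat)) ->
  definable_fun a -> definable_fun b -> definable (fun e => S (a e) (b e)).
Proof.
  intros HS Ha Hb.
  exact (definable_subst _ _ HS (definable_pair_env a b Ha Hb)).
Qed.

Lemma definable_lt a b : definable_fun a -> definable_fun b -> definable (fun e => a e < b e).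
Proof.
  apply definable_rel with (S := Rlt).
  exact (QE.definable_lt_term (QE.term_fun_var _ 0) (QE.term_fun_var _ 1)).
Qed.

Lemma definable_gt a b : definable_fun a -> definable_fun b -> definable (fun e => a e > b e).
Proof. intros Ha Hb. now apply definable_lt. Qed.

Lemma definable_le a b : definable_fun a -> definable_fun b -> definable (fun e => a e <= b e).
Proof.
  intros Ha Hb. apply definable_ext with (fun e => ~ b e < a e).
  - intros e. split; [apply Rnot_lt_le|apply Rle_not_lt].
  - now apply definable_not, definable_lt.
Qed.

Lemma definable_eq a b : definable_fun a -> definable_fun b -> definable (fun e => a e = b e).
Proof.
  apply definable_rel with (S := eq).
  exact (QE.qf_definable_eq (QE.term_fun_var _ 0) (QE.term_fun_var _ 1)).
Qed.

Definition definable_real_fun (g : R -> R) : Prop :=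
  definable (fun e => e 0%nat = g (e 1%nat)).

Lemma definable_app g a : definable_real_fun g -> definable_fun a ->
  definable_fun (fun e => g (a e)).
Proof.
  intros Hg Ha.
  exact (definable_fun_subst (fun e => g (e 0%nat)) (fun _ => a) Hg (fun _ => Ha)).
Qed.

Lemma definable_exists_lt n (P : nat -> (nat -> R) -> Prop) :
  (forall i, (i < n)%nat -> definable (P i)) ->
  definable (fun e => exists i, (i < n)%nat /\ P i e).
Proof.
  induction n as [|n IH]; intros H.
  - apply definable_ext with (fun e => e 0%nat < e 0%nat).
    + intros e. split; [lra|]. intros (i & Hi & _). lia.
    + apply definable_lt; apply definable_var.
  - apply definable_ext with (fun e => (exists i, (i < n)%nat /\ P i e) \/ P n e).
    + intros e. split.
      * intros [(i & Hi & K)|K]; [exists i|exists n]; split; auto.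
      * intros (i & Hi & K). destruct (Nat.eq_dec i n) as [->|]; [now right|].
        left. exists i. split; [lia|exact K].
    + apply definable_or; [apply IH; intros; apply H; lia|apply H; lia].
Qed.

Lemma definable_forall_lt n (P : nat -> (nat -> R) -> Prop) :
  (forall i, (i < n)%nat -> definable (P i)) ->
  definable (fun e => forall i, (i < n)%nat -> P i e).
Proof.
  intros H. apply definable_ext with (fun e => ~ exists i, (i < n)%nat /\ ~ P i e).
  - intros e. split; [|firstorder].
    intros K i Hi. apply NNPP. intros N. apply K. now exists i.
  - apply definable_not, (definable_exists_lt n (fun i e => ~ P i e)).
    intros i Hi. now apply definable_not, H.
Qed.

(** Only the first [n] entries of [z] count, so [n] real quantifiers suffice. In the second
    hypothesis [e] itself plays [z]: its entries from [n] on are the parameters, which [Q] does not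
    see as part of [z]. *)
Lemma definable_exists_point n (Q : (nat -> R) -> (nat -> R) -> Prop) :
  (forall z z' e, (forall i, (i < n)%nat -> z i = z' i) -> Q z e -> Q z' e) ->
  definable (fun e => Q e (fun i => e (n + i)%nat)) ->
  definable (fun e => exists z, Q z e).
Proof.
  revert Q. induction n as [|n IH]; intros Q Hext HQ.
  - apply definable_ext with (2 := HQ). intros e. simpl. split.
    + intros H. now exists e.
    + intros (z & H). apply Hext with (2 := H). intros; lia.
  - apply definable_ext with (fun e => exists z, exists x, Q (scons x z) e).
    + intros e. split; [intros (z & x & H); now exists (scons x z)|].
      intros (z & H). exists (shift z), (z 0%nat).
      apply Hext with (2 := H). now intros [|i].
    + apply IH with (Q := fun z e => exists x, Q (scons x z) e).
      * intros z z' e H (x & K). exists x. apply Hext with (2 := K).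
        intros [|i] Hi; [reflexivity|]. apply H. lia.
      * apply (definable_exists (fun x e => Q (scons x e) (fun i => e (n + i)%nat))).
        apply definable_ext with (2 := HQ). intros e.
        replace (scons (e 0%nat) (shift e)) with e; [reflexivity|].
        apply functional_extensionality. now intros [|i].
Qed.

Ltac definable :=
  repeat (unfold shift; cbv beta;
  lazymatch goal with
  | H : definable ?P |- definable ?P => exact H
  | |- definable (fun e => _ /\ _) => apply definable_and
  | |- definable (fun e => _ \/ _) => apply definable_or
  | |- definable (fun e => ~ _) => apply definable_not
  | |- definable (fun e => exists x : R, @?Q e x) =>
      apply (definable_exists (fun x e => Q e x))
  | |- definable (fun e => forall x : R, @?Q e x) =>
      apply (definable_forall (fun x e => Q e x))
  | |- definable (fun e => @?A e -> @?B e) => apply (definable_imp A B)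
  | |- definable (fun e => _ < _) => apply definable_lt
  | |- definable (fun e => _ > _) => apply definable_gt
  | |- definable (fun e => _ <= _) => apply definable_le
  | |- definable (fun e => _ = _) => apply definable_eq
  | H : definable (fun e => ?S (e 0%nat) (e 1%nat)) |- definable (fun e => ?S _ _) =>
      apply (definable_rel S _ _ H)
  | |- definable_fun (fun e => e _) => apply definable_var
  | |- definable_fun (fun e => _ + _) => apply definable_plus
  | |- definable_fun (fun e => _ - _) => apply definable_minus
  | |- definable_fun (fun e => _ * _) => apply definable_mult
  | |- definable_fun (fun e => - _) => apply definable_opp
  | |- definable_fun (fun _ => ?c) => apply (definable_const c)
  | H : definable_real_fun ?g |- definable_fun (fun e => ?g _) =>
      apply (definable_app g _ H)
  end).

(** * Definable functions of one variable near zero *)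

Lemma Rabs_le_inv x a : Rabs x <= a -> - a <= x <= a.
Proof. intros H. pose proof (Rle_abs x). pose proof (Rle_abs (- x)). rewrite Rabs_Ropp in *. lra. Qed.

Definition eventually (P : R -> Prop) : Prop :=
  exists d, 0 < d /\ forall t, 0 < t -> t < d -> P t.

Lemma eventually_imp (P Q : R -> Prop) :
  (forall t, 0 < t -> P t -> Q t) -> eventually P -> eventually Q.
Proof. intros H (d & Hd & K). exists d. split; auto. Qed.

Lemma eventually_and P Q : eventually P -> eventually Q -> eventually (fun t => P t /\ Q t).
Proof.
  intros (d & Hd & K) (d' & Hd' & K'). exists (Rmin d d').
  split; [now apply Rmin_pos|]. intros t Ht Hm.
  pose proof (Rmin_l d d'). pose proof (Rmin_r d d').
  split; [apply K|apply K']; lra.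
Qed.

Lemma eventually_inhabited P : eventually P -> exists t, 0 < t /\ P t.
Proof. intros (d & Hd & K). exists (d / 2). split; [lra|]. apply K; lra. Qed.

Lemma eventually_lt d : 0 < d -> eventually (fun t => t < d).
Proof. intros Hd. exists d. auto. Qed.

Lemma eventually_forall_lt n (P : nat -> R -> Prop) :
  (forall i, (i < n)%nat -> eventually (P i)) ->
  eventually (fun t => forall i, (i < n)%nat -> P i t).
Proof.
  induction n as [|n IH]; intros H.
  - exists 1. split; [lra|]. intros; lia.
  - assert (A : eventually (fun t => (forall i, (i < n)%nat -> P i t) /\ P n t)).
    { apply eventually_and; [apply IH; intros; apply H; lia|apply H; lia]. }
    revert A. apply eventually_imp. intros t _ [A B] i Hi.
    destruct (Nat.eq_dec i n) as [->|]; [exact B|apply A; lia].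
Qed.

(** Below, this mostly serves to turn a mere failure of [eventually P] into the failure of [P] at
    every small argument. *)
Lemma germ_dichotomy (P : R -> Prop) :
  definable (fun e => P (e 0%nat)) -> eventually P \/ eventually (fun t => ~ P t).
Proof.
  intros H. destruct (QE.definable_germ (fun _ => 0) H) as (d & Hd & [K|K]);
    [left|right]; now exists d.
Qed.

Lemma definable_affine (P : R -> Prop) p c :
  definable (fun e => P (e 0%nat)) -> definable (fun e => P (p + c * e 0%nat)).
Proof.
  intros H. apply (definable_subst (fun e => P (e 0%nat)) (fun _ e => p + c * e 0%nat) H).
  intros _. definable.
Qed.

Lemma right_germ (P : R -> Prop) p : definable (fun e => P (e 0%nat)) ->
  eventually (fun t => P (p + t)) \/ eventually (fun t => ~ P (p + t)).
Proof.
  intros H. apply (germ_dichotomy (fun t => P (p + t))).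
  apply definable_ext with (2 := definable_affine P p 1 H).
  intros e. now rewrite Rmult_1_l.
Qed.

(* Baire's theorem for sets whose right germ at each point is trivial: a set
   without interior is then avoided by a small interval next to any point. *)
Lemma definable_cover_interval (E : nat -> R -> Prop) a b : a < b ->
  (forall m, definable (fun e => E m (e 0%nat))) ->
  (forall x, a < x < b -> exists m, E m x) ->
  exists m c d, a <= c /\ c < d /\ d <= b /\ forall x, c < x < d -> E m x.
Proof.
  intros Hab HE Hcov. apply NNPP. intros N.
  assert (step : forall m (I : R * R), exists J : R * R,
    a <= fst I -> fst I < snd I -> snd I <= b ->
    fst I < fst J /\ fst J < snd J /\ snd J < snd I /\
    forall x, fst J <= x <= snd J -> ~ E m x).
  { intros m [c d]. simpl.
    destruct (classic (a <= c /\ c < d /\ d <= b)) as [(H1 & H2 & H3)|H];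
      [|exists (0, 0); tauto].
    (* If [E m] contained a right neighbourhood of [p], that interval would contradict [N]. So [E m]
       misses one, and a closed interval just right of [p] avoids [E m]. *)
    pose (p := (c + d) / 2).
    destruct (right_germ (E m) p (HE m)) as [(h & Hh & K)|(h & Hh & K)].
    - exfalso. apply N.
      pose proof (Rmin_l (p + h) d). pose proof (Rmin_r (p + h) d).
      exists m, p, (Rmin (p + h) d). unfold p in *. repeat split; try lra.
      + apply Rmin_glb_lt; lra.
      + intros x Hx. replace x with ((c + d) / 2 + (x - (c + d) / 2)) by ring.
        apply K; lra.
    - pose (h' := Rmin h (d - p)).
      assert (0 < h') by (apply Rmin_pos; unfold p; lra).
      pose proof (Rmin_l h (d - p)). pose proof (Rmin_r h (d - p)).
      fold h' in H0, H4. exists (p + h' / 3, p + h' / 2). simpl. intros _ _ _.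
      unfold p in *. repeat split; try lra.
      intros x Hx. replace x with ((c + d) / 2 + (x - (c + d) / 2)) by ring.
      apply K; lra. }
  pose (next := fun m I => proj1_sig (constructive_indefinite_description _ (step m I))).
  pose (I := fix I m := match m with O => (a, b) | S m => next m (I m) end).
  assert (HI : forall m, a <= fst (I m) /\ fst (I m) < snd (I m) /\ snd (I m) <= b).
  { induction m as [|m IH]; simpl; [lra|].
    unfold next. destruct (constructive_indefinite_description _ (step m (I m))) as [J HJ].
    simpl. destruct IH as (A & B & C). destruct (HJ A B C) as (? & ? & ? & _). lra. }
  assert (Hstep : forall m, fst (I m) < fst (I (S m)) /\ snd (I (S m)) < snd (I m) /\
    forall x, fst (I (S m)) <= x <= snd (I (S m)) -> ~ E m x).
  { intros m. simpl. unfold next.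
    destruct (constructive_indefinite_description _ (step m (I m))) as [J HJ].
    simpl. destruct (HI m) as (A & B & C). destruct (HJ A B C) as (? & ? & ? & ?). auto. }
  assert (mono : forall m k, fst (I m) <= fst (I (m + k)%nat) /\ snd (I (m + k)%nat) <= snd (I m)).
  { intros m. induction k as [|k IH]; [rewrite Nat.add_0_r; lra|].
    rewrite Nat.add_succ_r. destruct (Hstep (m + k)%nat) as (? & ? & _). lra. }
  assert (cross : forall m k, fst (I m) <= snd (I k)).
  { intros m k. destruct (mono m k) as [A _]. destruct (mono k m) as [_ B].
    rewrite Nat.add_comm in B. destruct (HI (m + k)%nat). lra. }
  (* The supremum of the left ends lies in all the nested intervals, hence in no [E m]; the strict
     shrinking at the first step puts it strictly between [a] and [b]. *)
  destruct (completeness (fun x => exists m, x = fst (I m))) as [x [Hx1 Hx2]].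
  { exists (snd (I 0%nat)). intros y [m ->]. apply cross. }
  { exists (fst (I 0%nat)). now exists 0%nat. }
  assert (Hx : forall m, fst (I m) <= x <= snd (I m)).
  { intros m. split; [apply Hx1; now exists m|].
    apply Hx2. intros y [k ->]. apply cross. }
  destruct (Hcov x) as [m Hm].
  - destruct (Hx 1%nat), (Hstep 0%nat) as (? & ? & _). simpl in *. lra.
  - destruct (Hstep m) as (_ & _ & H). exact (H x (Hx (S m)) Hm).
Qed.

(** No continuity is assumed. Let [x] be the supremum of the points up to which [g] stays above
    [g a]: the left condition at [x] gives [g a < g x], and the right one would push [x] further if
    [x < b]. *)
Lemma locally_increasing (g : R -> R) a b : a < b ->
  (forall t, a <= t <= b -> eventually (fun s => g (t - s) < g t)) ->
  (forall t, a <= t <= b -> eventually (fun s => g t < g (t + s))) ->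
  g a < g b.
Proof.
  intros Hab HL HR.
  pose (S x := a < x <= b /\ forall y, a < y <= x -> g a < g y).
  assert (S0 : exists x, S x).
  { destruct (HR a) as (h & Hh & K); [lra|].
    pose proof (Rmin_l (h / 2) (b - a)). pose proof (Rmin_r (h / 2) (b - a)).
    assert (0 < Rmin (h / 2) (b - a)) by (apply Rmin_pos; lra).
    exists (a + Rmin (h / 2) (b - a)). split; [lra|].
    intros y Hy. replace y with (a + (y - a)) by ring. apply K; lra. }
  destruct (completeness S) as [x [Hx1 Hx2]].
  { exists b. intros y [Hy _]. lra. }
  { exact S0. }
  destruct S0 as [x0 Hx0]. pose proof (Hx1 x0 Hx0) as Hx0x.
  assert (Hxb : x <= b) by (apply Hx2; intros y [Hy _]; lra).
  assert (Hax : a < x) by (destruct Hx0; lra).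
  assert (below : forall y, a < y < x -> g a < g y).
  { intros y Hy. apply NNPP. intros N.
    assert (x <= y); [|lra]. apply Hx2. intros z [Hz Kz].
    apply Rnot_lt_le. intros Hyz. apply N, Kz. lra. }
  assert (Hgx : g a < g x).
  { destruct (HL x) as (h & Hh & K); [lra|].
    pose proof (Rmin_l h (x - a)). pose proof (Rmin_r h (x - a)).
    assert (0 < Rmin h (x - a)) by (apply Rmin_pos; lra).
    apply Rlt_trans with (g (x - Rmin h (x - a) / 2)); [apply below|apply K]; lra. }
  destruct (Rle_lt_or_eq_dec x b Hxb) as [Hlt| ->]; [exfalso|exact Hgx].
  destruct (HR x) as (h & Hh & K); [lra|].
  pose proof (Rmin_l (h / 2) (b - x)). pose proof (Rmin_r (h / 2) (b - x)).
  assert (0 < Rmin (h / 2) (b - x)) by (apply Rmin_pos; lra).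
  assert (x + Rmin (h / 2) (b - x) <= x); [|lra].
  apply Hx1. split; [lra|]. intros y Hy.
  destruct (Rlt_or_le x y) as [Hxy|Hxy].
  - apply Rlt_trans with (g x); [exact Hgx|].
    replace y with (x + (y - x)) by ring. apply K; lra.
  - destruct (Req_dec y x) as [->|]; [exact Hgx|apply below; lra].
Qed.

(** Otherwise no small point has growth on its right. Baire makes both local conditions hold with
    one bound on the step over a whole interval. For two of its points at a small distance [s], the
    left condition at the later one contradicts the absence of growth at the earlier one. *)
Lemma eventually_right_growth (g : R -> R) : definable_real_fun g ->
  eventually (fun t => eventually (fun s => g (t - s) < g t)) ->
  eventually (fun t => eventually (fun s => g t < g (t + s))).
Proof.
  intros Hg HL.
  destruct (germ_dichotomy (fun t => eventually (fun s => g t < g (t + s)))) as [H|H];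
    [unfold eventually; definable|exact H|exfalso].
  destruct (eventually_and _ _ HL H) as (d & Hd & K).
  assert (HR : forall t, 0 < t < d -> eventually (fun s => ~ g t < g (t + s))).
  { intros t Ht. destruct (K t) as [_ K2]; try lra.
    destruct (germ_dichotomy (fun s => g t < g (t + s))) as [A|A];
      [definable|now elim K2|exact A]. }
  pose (E m t := forall s, 0 < s -> s < / INR (S m) ->
                 g (t - s) < g t /\ ~ g t < g (t + s)).
  destruct (definable_cover_interval E 0 d Hd) as (m & a & b & Ha & Hab & Hb & HE).
  - intros m. unfold E. definable.
  - intros t Ht.
    destruct (eventually_and _ _ (proj1 (K t (proj1 Ht) (proj2 Ht))) (HR t Ht)) as (h & Hh & Kh).
    destruct (archimed_cor1 h Hh) as (m & Hm & Hm0).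
    exists m. intros s Hs Hs'. apply Kh; [exact Hs|].
    apply Rlt_trans with (1 := Hs'). apply Rle_lt_trans with (2 := Hm).
    apply Rinv_le_contravar; [now apply lt_0_INR|]. rewrite S_INR. lra.
  - assert (Hm : 0 < / INR (S m)) by (apply Rinv_0_lt_compat, lt_0_INR; lia).
    pose proof (Rmin_l (/ INR (S m)) (b - a)). pose proof (Rmin_r (/ INR (S m)) (b - a)).
    assert (0 < Rmin (/ INR (S m)) (b - a)) by (apply Rmin_pos; lra).
    (* Both [a + s / 2] and [a + s / 2 + s] then lie inside the interval: their offsets from [a] are
       at most [3 * (b - a) / 4]. *)
    set (s := Rmin (/ INR (S m)) (b - a) / 2).
    assert (Hs : 0 < s /\ s < / INR (S m) /\ s <= (b - a) / 2) by (unfold s; lra).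
    clearbody s.
    destruct (HE (a + s / 2)) with (s := s) as [_ H3]; try lra.
    destruct (HE (a + s / 2 + s)) with (s := s) as [H4 _]; try lra.
    apply H3. now replace (a + s / 2 + s - s) with (a + s / 2) in H4 by ring.
Qed.

Lemma eventually_increasing (g : R -> R) : definable_real_fun g ->
  eventually (fun t => eventually (fun s => g (t - s) < g t)) ->
  exists d, 0 < d /\ forall s t, 0 < s -> s < t -> t < d -> g s < g t.
Proof.
  intros Hg HL.
  destruct (eventually_and _ _ HL (eventually_right_growth g Hg HL)) as (d & Hd & K).
  exists d. split; [exact Hd|]. intros s t Hs Hst Ht.
  apply locally_increasing; [exact Hst|intros x Hx; apply K; lra..].
Qed.

Definition little_o (k : R -> R) : Prop :=
  forall eps, 0 < eps -> eventually (fun t => Rabs (k t) <= eps * t).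

(** Otherwise [k t - eps * t] is increasing near 0; as it tends to 0 at 0+, it is nonnegative there,
    yet for small [t] it is at most [- eps * t / 2]. *)
Lemma little_o_no_growth (k : R -> R) eps : definable_real_fun k -> little_o k -> 0 < eps ->
  eventually (fun t => ~ eventually (fun s => k t - k (t - s) > eps * s)).
Proof.
  intros Hk Ho Heps.
  destruct (germ_dichotomy (fun t => eventually (fun s => k t - k (t - s) > eps * s))) as [H|H];
    [unfold eventually; definable|exfalso|exact H].
  destruct (eventually_increasing (fun t => k t - eps * t)) as (d & Hd & K).
  - unfold definable_real_fun. definable.
  - revert H. apply eventually_imp. intros t _. apply eventually_imp. intros s _ Hs.
    replace (eps * (t - s)) with (eps * t - eps * s) by ring. lra.
  - destruct (Ho (eps / 2)) as (d1 & Hd1 & K1); [lra|].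
    destruct (eventually_inhabited _ (eventually_and _ _ (eventually_lt d Hd) (eventually_lt d1 Hd1)))
      as (t & Ht & Htd & Htd1).
    destruct (Ho 1) as (d2 & Hd2 & K2); [lra|].
    (* Chosen so that [(1 + eps) * s <= eps * t / 4]; with [Rabs (k s) <= s] this keeps
       [k s - eps * s] above [- eps * t / 2]. *)
    pose (s := Rmin (Rmin d2 t) (eps * t / (4 * (1 + eps))) / 2).
    assert (Hq : 0 < eps * t / (4 * (1 + eps))).
    { apply Rdiv_lt_0_compat; [now apply Rmult_lt_0_compat|lra]. }
    pose proof (Rmin_l (Rmin d2 t) (eps * t / (4 * (1 + eps)))).
    pose proof (Rmin_r (Rmin d2 t) (eps * t / (4 * (1 + eps)))).
    pose proof (Rmin_l d2 t). pose proof (Rmin_r d2 t).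
    assert (0 < Rmin (Rmin d2 t) (eps * t / (4 * (1 + eps)))) by (repeat apply Rmin_pos; lra).
    assert (Hs : 0 < s /\ s < d2 /\ s < t /\ s <= eps * t / (4 * (1 + eps))) by (unfold s; lra).
    clearbody s. destruct Hs as (Hs & Hs2 & Hst & Hse).
    pose proof (K s t Hs Hst Htd) as A.
    pose proof (K1 t Ht Htd1) as B. pose proof (K2 s Hs Hs2) as C.
    apply Rabs_le_inv in B. apply Rabs_le_inv in C.
    assert (D : s * (1 + eps) <= eps * t / 4).
    { apply Rmult_le_compat_r with (r := 1 + eps) in Hse; [|lra].
      replace (eps * t / (4 * (1 + eps)) * (1 + eps)) with (eps * t / 4) in Hse by (field; lra).
      exact Hse. }
    assert (0 < eps * t) by now apply Rmult_lt_0_compat.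
    lra.
Qed.

(** The one-sided bound for [k] and for [- k]: in each case the germ in [s] of excessive growth is
    full, which is excluded, or empty. *)
Lemma little_o_slope (k : R -> R) eps : definable_real_fun k -> little_o k -> 0 < eps ->
  eventually (fun t => eventually (fun s => Rabs (k (t - s) - k t) <= eps * s)).
Proof.
  intros Hk Ho Heps.
  assert (Hk' : definable_real_fun (fun t => - k t)) by (unfold definable_real_fun; definable).
  assert (Ho' : little_o (fun t => - k t)).
  { intros e He. destruct (Ho e He) as (d & Hd & K). exists d. split; [exact Hd|].
    intros t Ht Ht'. rewrite Rabs_Ropp. now apply K. }
  generalize (eventually_and _ _ (little_o_no_growth k eps Hk Ho Heps)
                (little_o_no_growth _ eps Hk' Ho' Heps)).
  apply eventually_imp. intros t Ht [A B].
  destruct (germ_dichotomy (fun s => k t - k (t - s) > eps * s)) as [A'|A'];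
    [definable|now elim A|].
  destruct (germ_dichotomy (fun s => - k t - - k (t - s) > eps * s)) as [B'|B'];
    [definable|now elim B|].
  generalize (eventually_and _ _ A' B'). apply eventually_imp. intros s _ [C D].
  apply Rabs_le. lra.
Qed.

(** [L] is the supremum of the eventual lower bounds of [g]. Were [g] not eventually below
    [L + eps], the dichotomy would make [L + eps] such a lower bound too. *)
Lemma definable_limit (g : R -> R) M : definable_real_fun g ->
  eventually (fun t => Rabs (g t) <= M) ->
  exists L, forall eps, 0 < eps -> eventually (fun t => Rabs (g t - L) <= eps).
Proof.
  intros Hg HM.
  destruct (completeness (fun a => eventually (fun t => a <= g t))) as [L [HL1 HL2]].
  - exists M. intros a Ha.
    destruct (eventually_inhabited _ (eventually_and _ _ Ha HM)) as (t & _ & A & B).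
    apply Rabs_le_inv in B. lra.
  - exists (- M). revert HM. apply eventually_imp. intros t _ H. apply Rabs_le_inv in H. lra.
  - exists L. intros eps Heps.
    assert (A : eventually (fun t => L - eps <= g t)).
    { apply NNPP. intros N. assert (L <= L - eps); [|lra].
      apply HL2. intros a Ha. apply Rnot_lt_le. intros Hlt. apply N.
      revert Ha. apply eventually_imp. intros; lra. }
    destruct (germ_dichotomy (fun t => L + eps <= g t)) as [B|B]; [definable| |].
    + pose proof (HL1 _ B). lra.
    + generalize (eventually_and _ _ A B). apply eventually_imp. intros t _ [C D].
      apply Rabs_le. lra.
Qed.

(** * Definable choice *)

Definition is_inf (S : R -> Prop) (m : R) : Prop :=
  (forall y, S y -> m <= y) /\ (forall m', (forall y, S y -> m' <= y) -> m' <= m).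

Lemma is_inf_unique S m m' : is_inf S m -> is_inf S m' -> m = m'.
Proof. intros [A B] [A' B']. apply Rle_antisym; auto. Qed.

Lemma is_inf_exists (S : R -> Prop) M :
  (exists y, S y) -> (forall y, S y -> M <= y) -> exists m, is_inf S m.
Proof.
  intros [y0 Hy0] HM.
  destruct (completeness (fun a => forall y, S y -> a <= y)) as [m [H1 H2]].
  - exists y0. intros a Ha. now apply Ha.
  - now exists M.
  - exists m. split.
    + intros y Hy. apply H2. intros a Ha. now apply Ha.
    + intros m' H. now apply H1.
Qed.

(* The least element of [S] if there is one; otherwise, [m] being the infimum of
   [S] and [(m, b)] the longest such interval inside [S] with [b <= m + 1], its
   midpoint. *)
Definition selected (S : R -> Prop) (y : R) : Prop :=
  exists m, is_inf S m /\
    ((S m /\ y = m) \/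
     (~ S m /\ exists b, is_inf (fun x => m < x /\ (x = m + 1 \/ ~ S x)) b /\ y + y = m + b)).

Lemma selected_unique S y y' : selected S y -> selected S y' -> y = y'.
Proof.
  intros (m & Hm & H) (m' & Hm' & H').
  rewrite <- (is_inf_unique S m m' Hm Hm') in H'.
  destruct H as [[A ->]|[A (b & Hb & Hy)]], H' as [[A' ->]|[A' (b' & Hb' & Hy')]]; try tauto.
  pose proof (is_inf_unique _ b b' Hb Hb'). lra.
Qed.

(** If the infimum [m] is not attained, [S] contains a right neighbourhood of [m]: otherwise it
    would miss one and have a larger lower bound. Hence [m < b], and the midpoint, lying below [b],
    is in [S]. *)
Lemma selected_spec (S : R -> Prop) M : definable (fun e => S (e 0%nat)) ->
  (exists y, S y) -> (forall y, S y -> M <= y) -> exists y, selected S y /\ S y.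
Proof.
  intros HS Hne HM.
  destruct (is_inf_exists S M Hne HM) as [m Hm].
  destruct (classic (S m)) as [Sm|Sm].
  - exists m. split; [|exact Sm]. exists m. auto.
  - destruct (is_inf_exists (fun x => m < x /\ (x = m + 1 \/ ~ S x)) m) as [b Hb].
    + exists (m + 1). split; [lra|now left].
    + intros y [H _]. lra.
    + assert (Hmb : m < b).
      { destruct (right_germ S m HS) as [(h & Hh & K)|(h & Hh & K)].
        - pose proof (Rmin_l h 1). pose proof (Rmin_r h 1).
          assert (0 < Rmin h 1) by (apply Rmin_pos; lra).
          assert (m + Rmin h 1 <= b); [|lra].
          apply (proj2 Hb). intros y [Hy [->|Ny]]; [lra|].
          apply Rnot_lt_le. intros Hlt. apply Ny.
          replace y with (m + (y - m)) by ring. apply K; lra.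
        - assert (m + h <= m); [|lra]. apply (proj2 Hm). intros y Hy.
          apply Rnot_lt_le. intros Hlt. pose proof (proj1 Hm y Hy).
          destruct (Req_dec y m) as [->|]; [tauto|].
          apply (K (y - m)); try lra. now replace (m + (y - m)) with y by ring. }
      exists ((m + b) / 2). split.
      * exists m. split; [exact Hm|right; split; [exact Sm|]]. exists b. split; [exact Hb|lra].
      * apply NNPP. intros N.
        assert (b <= (m + b) / 2); [|lra]. apply (proj1 Hb). split; [lra|now right].
Qed.

(** An arbitrary choice function has no reason to be definable; [selected] is a first-order
    condition with at most one solution, so it yields a definable graph. The bound [M] provides the
    infima. *)
Lemma definable_choice (P : R -> R -> Prop) M :
  definable (fun e => P (e 0%nat) (e 1%nat)) -> (forall t y, P t y -> M <= y) ->
  exists g, definable_real_fun g /\ forall t, (exists y, P t y) -> P t (g t).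
Proof.
  intros HP HM.
  (* The default value 0 makes the function total while its graph stays definable. *)
  assert (A : forall t, exists y, selected (P t) y \/ (~ (exists y, selected (P t) y) /\ y = 0)).
  { intros t. destruct (classic (exists y, selected (P t) y)) as [[y H]|H].
    - exists y. now left.
    - exists 0. now right. }
  exists (fun t => proj1_sig (constructive_indefinite_description _ (A t))). split.
  - apply definable_ext with (fun e => selected (P (e 1%nat)) (e 0%nat) \/
      (~ (exists y, selected (P (e 1%nat)) y) /\ e 0%nat = 0)).
    + intros e. destruct (constructive_indefinite_description _ (A (e 1%nat))) as [y Hy].
      simpl. split.
      * destruct Hy as [H|[H ->]]; intros [K|[K Ke]]; auto.
        -- now apply selected_unique with (P (e 1%nat)).
        -- elim K. now exists y.
        -- elim H. now exists (e 0%nat).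
      * now intros ->.
    + unfold selected, is_inf. definable.
  - intros t Ht. destruct (constructive_indefinite_description _ (A t)) as [y Hy].
    destruct (selected_spec (P t) M) as (z & Hz & Pz).
    + definable.
    + exact Ht.
    + apply HM.
    + simpl. destruct Hy as [H|[H _]].
      * now rewrite (selected_unique _ _ _ H Hz).
      * elim H. now exists z.
Qed.

Lemma scons_shift (e : nat -> R) : scons (e 0%nat) (shift e) = e.
Proof. apply functional_extensionality. now intros [|i]. Qed.

(** Induction on [n]: the first coordinate is chosen in the projection of [P t], then the others in
    the fibre over it. The lower bounds [M i] are those that the choice of one real number asks
    for. *)
Lemma definable_curve_selection n : forall (P : R -> (nat -> R) -> Prop) (M : nat -> R),
  (forall t z z', (forall i, (i < n)%nat -> z i = z' i) -> P t z -> P t z') ->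
  (forall t z i, (i < n)%nat -> P t z -> M i <= z i) ->
  definable (fun e => P (e 0%nat) (shift e)) ->
  exists g : nat -> R -> R, (forall i, definable_real_fun (g i)) /\
    forall t, (exists z, P t z) -> P t (fun i => g i t).
Proof.
  induction n as [|n IH]; intros P M Hext HM HP.
  - exists (fun _ _ => 0). split.
    + intros i. unfold definable_real_fun. definable.
    + intros t [z Hz]. apply Hext with (2 := Hz). intros; lia.
  - destruct (definable_choice (fun t y => exists z, P t (scons y z)) (M 0%nat)) as (g0 & D0 & H0).
    + apply (definable_exists_point n (fun z e => P (e 0%nat) (scons (e 1%nat) z))).
      * intros z z' e H. apply Hext. intros [|i] Hi; [reflexivity|]. apply H. lia.
      (* The first [n] variables are the coordinates of [z]; behind them, position [n] holds [t] and
         position [n + 1] holds [y]. *)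
      * pose (r := fun i => match i with O => (n + 0)%nat | S O => (n + 1)%nat | S (S j) => j end).
        apply definable_ext with (2 := definable_rename _ r HP).
        intros e. replace (shift (fun i => e (r i))) with (scons (e (n + 1)%nat) e); [reflexivity|].
        apply functional_extensionality. now intros [|i].
    + intros t y [z Hz]. apply (HM t (scons y z) 0%nat); [lia|exact Hz].
    + destruct (IH (fun t z => P t (scons (g0 t) z)) (fun i => M (S i))) as (g & Dg & Hg).
      * intros t z z' H. apply Hext. intros [|i] Hi; [reflexivity|]. apply H. lia.
      * intros t z i Hi Hz. apply (HM t (scons (g0 t) z) (S i)); [lia|exact Hz].
      * apply definable_ext with (fun e => (fun e' => P (e' 0%nat) (shift e'))
          (fun i => match i with O => fun e => e 0%nat | S O => fun e => g0 (e 0%nat)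
                    | S (S j) => fun e => e (S j) end e)).
        -- intros e. match goal with |- P _ ?u <-> P _ ?v => replace u with v; [reflexivity|] end.
           apply functional_extensionality. intros [|i]; reflexivity.
        -- apply (definable_subst (fun e' => P (e' 0%nat) (shift e'))
             (fun i => match i with O => fun e => e 0%nat | S O => fun e => g0 (e 0%nat)
                       | S (S j) => fun e => e (S j) end) HP).
           intros [|[|i]]; definable.
      * exists (scons g0 g). split; [intros [|i]; [exact D0|apply Dg]|].
        intros t [z Hz].
        replace (fun i => scons g0 g i t) with (scons (g0 t) (fun i => g i t))
          by (apply functional_extensionality; now intros [|i]).
        apply Hg. destruct (H0 t) as [z' Hz'].
        -- exists (z 0%nat), (shift z). now rewrite scons_shift.
        -- now exists z'.
Qed.

(** * Points as sequences, the Euclidean norm, convergence *)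

Definition of_fun (n : nat) (p : nat -> R) : vec n := fun i => p (proj1_sig i).

Lemma coord_of_fun n p i : (i < n)%nat -> coord (of_fun n p) i = p i.
Proof. intros H. unfold coord. destruct (lt_dec i n); [reflexivity|lia]. Qed.

Lemma of_fun_coord n (x : vec n) : of_fun n (coord x) = x.
Proof.
  apply functional_extensionality. intros [i Hi]. unfold of_fun, coord. simpl.
  destruct (lt_dec i n) as [H|]; [|lia]. do 2 f_equal. apply Peano_dec.le_unique.
Qed.

Lemma of_fun_ext n p q : (forall i, (i < n)%nat -> p i = q i) -> of_fun n p = of_fun n q.
Proof. intros H. apply functional_extensionality. intros [i Hi]. now apply H. Qed.

Lemma coord_vsub n (x y : vec n) i : coord (vsub x y) i = coord x i - coord y i.
Proof. unfold coord, vsub. destruct (lt_dec i n); ring. Qed.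

Lemma coord_vscale n a (x : vec n) i : coord (vscale a x) i = a * coord x i.
Proof. unfold coord, vscale. destruct (lt_dec i n); ring. Qed.

(** [vnorm x] unfolds to the square root of [sum_sq n (coord x)]. Taking a sequence, not a [vec n],
    allows induction on [n] with [p] fixed. *)
Definition sum_sq (n : nat) (p : nat -> R) : R :=
  fold_right Rplus 0 (map (fun i => p i ^ 2) (seq 0 n)).

Lemma sum_sq_S n p : sum_sq (S n) p = sum_sq n p + p n ^ 2.
Proof.
  unfold sum_sq. rewrite seq_S, map_app, fold_right_app. simpl.
  generalize (map (fun i => p i * (p i * 1)) (seq 0 n)). intros l.
  induction l as [|a l IH]; simpl; [ring|rewrite IH; ring].
Qed.

Lemma sum_sq_nonneg n p : 0 <= sum_sq n p.
Proof.
  induction n as [|n IH]; [unfold sum_sq; simpl; lra|].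
  rewrite sum_sq_S. pose proof (pow2_ge_0 (p n)). lra.
Qed.

Lemma sq_le_sum_sq n p i : (i < n)%nat -> p i ^ 2 <= sum_sq n p.
Proof.
  induction n as [|n IH]; intros Hi; [lia|]. rewrite sum_sq_S.
  destruct (Nat.eq_dec i n) as [->|].
  - pose proof (sum_sq_nonneg n p). lra.
  - pose proof (pow2_ge_0 (p n)). specialize (IH ltac:(lia)). lra.
Qed.

Lemma abs_le_norm n p i : (i < n)%nat -> Rabs (p i) <= sqrt (sum_sq n p).
Proof.
  intros Hi. rewrite <- sqrt_Rsqr_abs. apply sqrt_le_1_alt.
  unfold Rsqr. pose proof (sq_le_sum_sq n p i Hi). simpl in H. lra.
Qed.

(** This crude factor is the origin of the tolerances [eps / (INR n + 1)] below; the added 1 covers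
    dimension 0 and makes the final inequality strict. *)
Lemma norm_le n p a : 0 <= a -> (forall i, (i < n)%nat -> Rabs (p i) <= a) ->
  sqrt (sum_sq n p) <= INR n * a.
Proof.
  intros Ha H.
  assert (A : sum_sq n p <= (INR n * a) ^ 2).
  { induction n as [|n IH]; [unfold sum_sq; simpl; lra|].
    rewrite sum_sq_S, S_INR.
    assert (p n ^ 2 <= a ^ 2) by (apply pow_maj_Rabs, H; lia).
    specialize (IH ltac:(intros; apply H; lia)).
    pose proof (pos_INR n). assert (0 <= INR n * (a * a)) by (apply Rmult_le_pos; nra). nra. }
  rewrite <- (sqrt_pow2 (INR n * a)); [now apply sqrt_le_1_alt|].
  apply Rmult_le_pos; [apply pos_INR|exact Ha].
Qed.

Lemma vcv_coord n (u : nat -> vec n) (l : vec n) :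
  (forall i, (i < n)%nat -> Un_cv (fun r => coord (u r) i) (coord l i)) -> vcv u l.
Proof.
  intros H eps Heps.
  assert (Hn : 0 < INR n + 1) by (pose proof (pos_INR n); lra).
  set (a := eps / (INR n + 1)).
  assert (Ha : 0 < a) by now apply Rdiv_lt_0_compat.
  assert (A : forall m, (m <= n)%nat -> exists N, forall r, (r >= N)%nat ->
    forall i, (i < m)%nat -> Rabs (coord (u r) i - coord l i) < a).
  { induction m as [|m IH]; intros Hm; [exists 0%nat; intros; lia|].
    destruct IH as [N HN]; [lia|]. destruct (H m ltac:(lia) a Ha) as [N' HN'].
    exists (Nat.max N N'). intros r Hr i Hi. destruct (Nat.eq_dec i m) as [->|].
    - apply HN'. lia.
    - apply HN; lia. }
  destruct (A n (le_n n)) as [N HN]. exists N. intros r Hr.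
  unfold Rdist. rewrite Rminus_0_r, Rabs_right by (apply Rle_ge, sqrt_pos).
  apply Rle_lt_trans with (INR n * a).
  - apply norm_le; [lra|]. intros i Hi. rewrite coord_vsub. left. now apply HN.
  - replace eps with ((INR n + 1) * a) by (unfold a; field; lra). lra.
Qed.

Definition tends (f : R -> R) (L : R) : Prop :=
  forall eps, 0 < eps -> eventually (fun t => Rabs (f t - L) <= eps).

(** The bridge from germs at 0+ to the sequences in the definition of the tangent cone. *)
Lemma tends_Un_cv f L d : 0 < d -> tends f L -> Un_cv (fun r => f (d / (INR r + 2))) L.
Proof.
  intros Hd H eps Heps. destruct (H (eps / 2)) as (h & Hh & K); [lra|].
  destruct (archimed_cor1 (h / d)) as (N & HN & HN0); [now apply Rdiv_lt_0_compat|].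
  exists N. intros r Hr. apply Rle_lt_trans with (eps / 2); [|lra]. apply K.
  - apply Rdiv_lt_0_compat; [exact Hd|]. pose proof (pos_INR r). lra.
  - apply Rlt_le_trans with (d * / INR N).
    + apply Rmult_lt_compat_l; [exact Hd|].
      apply Rinv_lt_contravar; apply le_INR in Hr; apply lt_0_INR in HN0; [nra|lra].
    + left. apply Rmult_lt_compat_l with (r := d) in HN; [|exact Hd].
      replace (d * (h / d)) with h in HN by (field; lra). exact HN.
Qed.

(** * Semi-algebraic sets as definable predicates *)

Lemma definable_peval n (p : poly n) : definable_fun (fun e => peval p (of_fun n e)).
Proof.
  induction p as [i Hi|c|p IHp q IHq|p IHp q IHq]; simpl.
  - unfold of_fun. simpl. definable.
  - definable.
  - now apply definable_plus.
  - now apply definable_mult.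
Qed.

Lemma definable_exists_In {A} (l : list A) (P : A -> (nat -> R) -> Prop) :
  (forall a, definable (P a)) -> definable (fun e => exists a, In a l /\ P a e).
Proof.
  intros H. induction l as [|a l IH].
  - apply definable_ext with (fun e => e 0%nat < e 0%nat); [|definable].
    intros e. split; [lra|]. now intros (a & [] & _).
  - apply definable_ext with (fun e => P a e \/ exists a, In a l /\ P a e).
    + intros e. simpl. firstorder. subst. auto.
    + now apply definable_or.
Qed.

Lemma definable_forall_In {A} (l : list A) (P : A -> (nat -> R) -> Prop) :
  (forall a, definable (P a)) -> definable (fun e => forall a, In a l -> P a e).
Proof.
  intros H. apply definable_ext with (fun e => ~ exists a, In a l /\ ~ P a e).
  - intros e. split; [|firstorder].
    intros K a Ha. apply NNPP. intros N. apply K. now exists a.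
  - apply definable_not, (definable_exists_In l (fun a e => ~ P a e)).
    intros a. now apply definable_not.
Qed.

Lemma semialgebraic_definable n (X : vec n -> Prop) :
  semialgebraic X -> definable (fun e => X (of_fun n e)).
Proof.
  intros [L HL].
  apply definable_ext with
    (fun e => exists c, In c L /\ basic_sa (fst c) (snd c) (of_fun n e)).
  - intros e. symmetry. apply HL.
  - apply (definable_exists_In L (fun c e => basic_sa (fst c) (snd c) (of_fun n e))).
    intros [eqs ineqs]. unfold basic_sa. simpl. apply definable_and.
    + apply (definable_forall_In eqs (fun f e => peval f (of_fun n e) = 0)).
      intros f. apply definable_eq; [apply definable_peval|apply definable_const].
    + apply (definable_forall_In ineqs (fun f e => peval f (of_fun n e) > 0)).
      intros f. apply definable_gt; [apply definable_peval|apply definable_const].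
Qed.

Lemma definable_sum_sq n (w : nat -> (nat -> R) -> R) :
  (forall i, definable_fun (w i)) -> definable_fun (fun e => sum_sq n (fun i => w i e)).
Proof.
  intros Hw. induction n as [|n IH].
  - apply (definable_const 0).
  - apply definable_fun_ext with (fun e => sum_sq n (fun i => w i e) + w n e * w n e).
    + intros e. rewrite sum_sq_S. ring.
    + apply definable_plus; [exact IH|]. now apply definable_mult.
Qed.

(** * Near radiality *)

(** The first-order counterpart, at the scale [s], of a vector near [u] being tangent to [X] at [p].
    Nearness is measured by a cube, not a ball, so that estimates are coordinatewise. *)
Definition approach n (X : vec n -> Prop) (eps : R) (p u : nat -> R) (s : R) : Prop :=
  exists z, (forall i, (i < n)%nat -> - eps <= z i - u i /\ z i - u i <= eps) /\
    X (of_fun n (fun i => p i + s * z i)).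

Lemma definable_approach n (X : vec n -> Prop) eps (p u : nat -> (nat -> R) -> R) s :
  definable (fun e => X (of_fun n e)) ->
  (forall i, definable_fun (p i)) -> (forall i, definable_fun (u i)) -> definable_fun s ->
  definable (fun e => approach n X eps (fun i => p i e) (fun i => u i e) (s e)).
Proof.
  intros HX Hp Hu Hs.
  apply (definable_exists_point n (fun z e =>
    (forall i, (i < n)%nat -> - eps <= z i - u i e /\ z i - u i e <= eps) /\
    X (of_fun n (fun i => p i e + s e * z i)))).
  - intros z z' e H [A B]. split.
    + intros i Hi. rewrite <- H by exact Hi. now apply A.
    + rewrite (of_fun_ext n _ (fun i => p i e + s e * z i)); [exact B|].
      intros i Hi. now rewrite H.
  - apply definable_and.
    + apply (definable_forall_lt n (fun i e =>
        - eps <= e i - u i (fun j => e (n + j)%nat) /\ e i - u i (fun j => e (n + j)%nat) <= eps)).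
      intros i _.
      pose proof (definable_fun_rename (u i) (fun j => (n + j)%nat) (Hu i)) as Hui.
      apply definable_and; apply definable_le; repeat apply definable_minus;
        try exact Hui; definable.
    + apply (definable_subst (fun e => X (of_fun n e)) (fun i e =>
        p i (fun j => e (n + j)%nat) + s (fun j => e (n + j)%nat) * e i) HX).
      intros i. apply definable_plus; [|apply definable_mult].
      * exact (definable_fun_rename (p i) (fun j => (n + j)%nat) (Hp i)).
      * exact (definable_fun_rename s (fun j => (n + j)%nat) Hs).
      * apply definable_var.
Qed.

(** Choosing [z] definably in [s] gives bounded definable coordinates, which converge at 0+, so no
    subsequence has to be extracted. The limit is tangent and stays in the closed cube. *)
Lemma tangent_of_approach n (X : vec n -> Prop) eps (x : vec n) (u : nat -> R) :
  definable (fun e => X (of_fun n e)) ->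
  eventually (approach n X eps (coord x) u) ->
  exists v, tangent_cone X x v /\ forall i, (i < n)%nat -> Rabs (u i - coord v i) <= eps.
Proof.
  intros HX Hev.
  destruct (definable_curve_selection n
    (fun s z => (forall i, (i < n)%nat -> - eps <= z i - u i /\ z i - u i <= eps) /\
       X (of_fun n (fun i => coord x i + s * z i))) (fun i => u i - eps))
    as (g & Dg & Hg).
  - intros s z z' H [A B]. split.
    + intros i Hi. rewrite <- H by exact Hi. now apply A.
    + rewrite (of_fun_ext n _ (fun i => coord x i + s * z i)); [exact B|].
      intros i Hi. now rewrite H.
  - intros s z i Hi [A _]. specialize (A i Hi). lra.
  - apply definable_and.
    + apply (definable_forall_lt n (fun i e =>
        - eps <= shift e i - u i /\ shift e i - u i <= eps)).
      intros i _. definable.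
    + apply (definable_subst (fun e => X (of_fun n e))
        (fun i e => coord x i + e 0%nat * shift e i) HX).
      intros i. definable.
  - assert (A : eventually (fun s =>
      (forall i, (i < n)%nat -> - eps <= g i s - u i /\ g i s - u i <= eps) /\
       X (of_fun n (fun i => coord x i + s * g i s)))).
    { revert Hev. apply eventually_imp. intros s _ [z Hz]. apply (Hg s). now exists z. }
    assert (B : forall i, exists L, (i < n)%nat -> tends (g i) L).
    { intros i. destruct (lt_dec i n) as [Hi|Hi]; [|exists 0; tauto].
      destruct (definable_limit (g i) (Rabs (u i) + eps) (Dg i)) as [L HL].
      - revert A. apply eventually_imp. intros s _ [A _]. specialize (A i Hi).
        replace (g i s) with (u i + (g i s - u i)) by ring.
        apply Rle_trans with (1 := Rabs_triang _ _).
        apply Rplus_le_compat_l, Rabs_le. lra.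
      - exists L. intros _. exact HL. }
    pose (L := fun i => proj1_sig (constructive_indefinite_description _ (B i))).
    assert (HL : forall i, (i < n)%nat -> tends (g i) (L i)).
    { intros i Hi. unfold L.
      destruct (constructive_indefinite_description _ (B i)) as [l Hl]. now apply Hl. }
    destruct A as (d & Hd & K).
    (* All sampled scales lie between 0 and [d], where the chosen curve is known to meet its
       constraints. *)
    pose (s := fun r : nat => d / 2 / (INR r + 2)).
    assert (Hs : forall r, 0 < s r < d).
    { intros r. pose proof (pos_INR r). unfold s. split.
      - apply Rdiv_lt_0_compat; lra.
      - apply Rmult_lt_reg_r with (INR r + 2); [lra|].
        replace (d / 2 / (INR r + 2) * (INR r + 2)) with (d / 2) by (field; lra). nra. }
    exists (of_fun n L). split.
    + exists s, (fun r => of_fun n (fun i => coord x i + s r * g i (s r))).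
      split; [apply Hs|]. split; [|split; [|split]].
      * apply (tends_Un_cv (fun t => t) 0 (d / 2)); [lra|].
        intros e He. exists e. split; [exact He|]. intros t Ht Ht'. apply Rabs_le. lra.
      * intros r. apply K; apply Hs.
      * apply vcv_coord. intros i Hi.
        apply (tends_Un_cv (fun t => coord (of_fun n (fun i => coord x i + t * g i t)) i)
          (coord x i) (d / 2)); [lra|].
        (* [M] bounds [Rabs (g i t)] for [t < d], so the displacement [t * g i t] is at most [e] in
           absolute value once [t < e / M]. *)
        intros e He. set (M := Rabs (u i) + Rabs eps + 1).
        assert (HM : 0 < M).
        { unfold M. pose proof (Rabs_pos (u i)). pose proof (Rabs_pos eps). lra. }
        exists (Rmin d (e / M)). split; [apply Rmin_pos; [lra|now apply Rdiv_lt_0_compat]|].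
        intros t Ht Ht'. pose proof (Rmin_l d (e / M)). pose proof (Rmin_r d (e / M)).
        rewrite coord_of_fun by exact Hi.
        replace (coord x i + t * g i t - coord x i) with (t * g i t) by ring.
        rewrite Rabs_mult, Rabs_right by lra.
        destruct (K t Ht) as [A _]; [lra|]. specialize (A i Hi).
        assert (Rabs (g i t) <= M).
        { unfold M. pose proof (Rle_abs (u i)). pose proof (Rle_abs (- u i)).
          pose proof (Rle_abs eps). rewrite Rabs_Ropp in *. apply Rabs_le. lra. }
        apply Rle_trans with (e / M * M); [|right; field; lra].
        apply Rmult_le_compat; try lra. apply Rabs_pos.
      * apply vcv_coord. intros i Hi. rewrite (coord_of_fun n L i Hi).
        intros e He.
        destruct (tends_Un_cv (g i) (L i) (d / 2) ltac:(lra) (HL i Hi) e He) as [N HN].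
        exists N. intros r Hr. specialize (HN r Hr).
        rewrite coord_vscale, coord_vsub, coord_of_fun by exact Hi.
        replace (/ s r * (coord x i + s r * g i (s r) - coord x i)) with (g i (s r));
          [exact HN|]. field. specialize (Hs r). lra.
    + intros i Hi. rewrite coord_of_fun by exact Hi.
      apply Rnot_lt_le. intros Hlt.
      destruct (HL i Hi ((Rabs (u i - L i) - eps) / 2)) as (h & Hh & Kh); [lra|].
      destruct (eventually_inhabited _ (eventually_and _ _ (eventually_lt d Hd) (eventually_lt h Hh)))
        as (t & Ht & Htd & Hth).
      destruct (K t Ht Htd) as [A _]. specialize (A i Hi). specialize (Kh t Ht Hth).
      assert (Rabs (u i - L i) <= eps + (Rabs (u i - L i) - eps) / 2); [|lra].
      replace (u i - L i) with (- (g i t - u i) + (g i t - L i)) at 1 by ring.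
      apply Rle_trans with (1 := Rabs_triang _ _). rewrite Rabs_Ropp.
      apply Rplus_le_compat; [apply Rabs_le; lra|exact Kh].
Qed.

(* The point [b + t w], at distance [t] from [b], violates near-radiality: the
   direction [- w] towards [b] is not nearly tangent to [X]. *)
Definition bad n (X : vec n -> Prop) (b : nat -> R) (eps t : R) (w : nat -> R) : Prop :=
  sum_sq n w = 1 /\ X (of_fun n (fun i => b i + t * w i)) /\
  eventually (fun s => ~ approach n X eps (fun i => b i + t * w i) (fun i => - w i) s).

Lemma bad_ext n (X : vec n -> Prop) b eps t w w' :
  (forall i, (i < n)%nat -> w i = w' i) -> bad n X b eps t w -> bad n X b eps t w'.
Proof.
  intros H (A & B & C).
  assert (E : forall f : nat -> R -> R, of_fun n (fun i => f i (w i)) = of_fun n (fun i => f i (w' i))).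
  { intros f. apply of_fun_ext. intros i Hi. now rewrite H. }
  split; [|split].
  - rewrite <- A. unfold sum_sq. f_equal. apply map_ext_in. intros i Hi.
    apply in_seq in Hi. rewrite H; [reflexivity|lia].
  - rewrite <- (E (fun i y => b i + t * y)). exact B.
  - revert C. apply eventually_imp. intros s _ C [z [Hz K]]. apply C. exists z. split.
    + intros i Hi. rewrite H by exact Hi. now apply Hz.
    + now rewrite (E (fun i y => b i + t * y + s * z i)).
Qed.

Lemma definable_bad n (X : vec n -> Prop) b eps : definable (fun e => X (of_fun n e)) ->
  definable (fun e => bad n X b eps (e 0%nat) (shift e)).
Proof.
  intros HX. unfold bad. apply definable_and; [|apply definable_and].
  - apply definable_eq; [|apply definable_const].
    apply (definable_sum_sq n (fun i e => shift e i)). intros i. definable.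
  - apply (definable_subst (fun e => X (of_fun n e)) (fun i e => b i + e 0%nat * shift e i) HX).
    intros i. definable.
  - unfold eventually.
    apply (definable_exists (fun d e => 0 < d /\ forall t, 0 < t -> t < d -> ~ approach n X eps
      (fun i => b i + e 0%nat * shift e i) (fun i => - shift e i) t)).
    apply definable_and; [definable|].
    apply (definable_forall (fun t e => 0 < t -> t < e 0%nat -> ~ approach n X eps
      (fun i => b i + shift e 0%nat * shift (shift e) i) (fun i => - shift (shift e) i) t)).
    apply definable_imp; [definable|]. apply definable_imp; [definable|].
    apply definable_not.
    apply (definable_approach n X eps (fun i e => b i + shift (shift e) 0%nat * shift (shift (shift e)) i)
      (fun i e => - shift (shift (shift e)) i) (fun e => e 0%nat) HX).
    + intros i. definable.
    + intros i. definable.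
    + definable.
Qed.

(** The bad points refute each other: seen from the one at [t], the one at [t - s] is a point of [X]
    lying nearly in the forbidden direction [- w]. *)
Lemma not_eventually_bad n (X : vec n -> Prop) b eps :
  definable (fun e => X (of_fun n e)) -> 0 < eps ->
  ~ eventually (fun t => exists w, bad n X b eps t w).
Proof.
  intros HX Heps Hev.
  (* The coordinates of a unit vector are at least -1, which is the lower bound required for the
     choice. *)
  destruct (definable_curve_selection n (bad n X b eps) (fun _ => -1)) as (g & Dg & Hg).
  - apply bad_ext.
  - intros t w i Hi (A & _). pose proof (abs_le_norm n w i Hi) as H.
    rewrite A, sqrt_1 in H. apply Rabs_le_inv in H. lra.
  - now apply definable_bad.
  - assert (B : eventually (fun t => bad n X b eps t (fun i => g i t))).
    { revert Hev. apply eventually_imp. intros t _ H. now apply Hg. }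
    clear Hg Hev.
    assert (C : forall i, exists c, (i < n)%nat -> tends (g i) c).
    { intros i. destruct (lt_dec i n) as [Hi|Hi]; [|exists 0; tauto].
      destruct (definable_limit (g i) 1 (Dg i)) as [c Hc].
      - revert B. apply eventually_imp. intros t _ (A & _).
        pose proof (abs_le_norm n (fun i => g i t) i Hi) as H. now rewrite A, sqrt_1 in H.
      - exists c. intros _. exact Hc. }
    pose (c := fun i => proj1_sig (constructive_indefinite_description _ (C i))).
    assert (Hc : forall i, (i < n)%nat -> tends (g i) (c i)).
    { intros i Hi. unfold c.
      destruct (constructive_indefinite_description _ (C i)) as [l Hl]. now apply Hl. }
    (* [k i] is the deviation of the coordinate [t * g i t] of the curve from its linear part
       [t * c i]. *)
    pose (k := fun i t => t * (g i t - c i)).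
    assert (Dk : forall i, definable_real_fun (k i)).
    { intros i. pose proof (Dg i). unfold definable_real_fun, k. definable. }
    assert (Ok : forall i, (i < n)%nat -> little_o (k i)).
    { intros i Hi e He. generalize (Hc i Hi e He). apply eventually_imp.
      intros t Ht H. unfold k. rewrite Rabs_mult, Rabs_right by lra. nra. }
    destruct B as (d & Hd & B).
    assert (S : eventually (fun t => t < d /\ forall i, (i < n)%nat ->
      eventually (fun s => Rabs (k i (t - s) - k i t) <= eps / 2 * s) /\
      Rabs (g i t - c i) <= eps / 2)).
    { apply eventually_and; [now apply eventually_lt|]. apply eventually_forall_lt.
      intros i Hi. apply eventually_and; [|apply Hc; [exact Hi|lra]].
      apply little_o_slope; [apply Dk|now apply Ok|lra]. }
    destruct (eventually_inhabited _ S) as (t & Ht & Htd & Sl).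
    destruct (B t Ht Htd) as (_ & _ & Hna).
    assert (Sl' : eventually (fun s => forall i, (i < n)%nat ->
      Rabs (k i (t - s) - k i t) <= eps / 2 * s)).
    { apply eventually_forall_lt. intros i Hi. apply Sl, Hi. }
    destruct (eventually_inhabited _ (eventually_and _ _ (eventually_and _ _ Hna Sl')
      (eventually_lt t Ht))) as (s & Hs & (Hns & Hsl) & Hst).
    apply Hns. exists (fun i => ((t - s) * g i (t - s) - t * g i t) / s). split.
    + intros i Hi. specialize (Hsl i Hi). destruct (Sl i Hi) as [_ Hgc].
      apply Rabs_le_inv in Hgc.
      (* The linear part contributes exactly [- c i], so the error splits into the slope of [k i]
         and the distance from [g i t] to its limit, each at most [eps / 2]. *)
      replace (((t - s) * g i (t - s) - t * g i t) / s - - g i t)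
        with ((k i (t - s) - k i t) / s + (g i t - c i)) by (unfold k; field; lra).
      assert (A : Rabs ((k i (t - s) - k i t) / s) <= eps / 2).
      { unfold Rdiv at 1. rewrite Rabs_mult, Rabs_inv, (Rabs_right s) by lra.
        apply Rmult_le_reg_r with s; [exact Hs|].
        rewrite Rmult_assoc, Rinv_l, Rmult_1_r by lra. exact Hsl. }
      apply Rabs_le_inv in A. lra.
    + destruct (B (t - s)) as (_ & H & _); [lra|lra|].
      rewrite (of_fun_ext n _ (fun i => b i + (t - s) * g i (t - s))); [exact H|].
      intros i Hi. field. lra.
Qed.

Lemma vnorm_vsub_sym n (x y : vec n) : vnorm (vsub x y) = vnorm (vsub y x).
Proof.
  unfold vnorm. do 2 f_equal. apply map_ext. intros i. rewrite !coord_vsub. ring.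
Qed.

Lemma vnorm_vsub_pos n (x y : vec n) : x <> y -> 0 < vnorm (vsub x y).
Proof.
  intros Hne. apply Rnot_le_lt. intros H. apply Hne.
  rewrite <- (of_fun_coord n x), <- (of_fun_coord n y). apply of_fun_ext. intros i Hi.
  pose proof (abs_le_norm n (coord (vsub x y)) i Hi) as A. rewrite coord_vsub in A.
  unfold vnorm in H. fold (sum_sq n (coord (vsub x y))) in H.
  apply Rle_trans with (2 := H), Rabs_le_inv in A. lra.
Qed.

Lemma sum_sq_scale n a p : sum_sq n (fun i => a * p i) = a ^ 2 * sum_sq n p.
Proof.
  induction n as [|n IH]; [unfold sum_sq; simpl; ring|]. rewrite !sum_sq_S, IH. ring.
Qed.

(** A direction approached at all small scales yields a tangent vector off by at most
    [eps / (INR n + 1)] in each coordinate, thus by less than [eps] in norm. By the dichotomy, a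
    direction not approached at all small scales is approached at no sufficiently small one. *)
Lemma bad_of_far n (X : vec n -> Prop) (xb x : vec n) eps :
  definable (fun e => X (of_fun n e)) -> 0 < eps -> X x -> x <> xb ->
  ~ dist_lt (vscale (/ vnorm (vsub xb x)) (vsub xb x)) (tangent_cone X x) eps ->
  exists w, bad n X (coord xb) (eps / (INR n + 1)) (vnorm (vsub x xb)) w.
Proof.
  intros HX Heps Hx Hne Hfar.
  pose proof (vnorm_vsub_pos n x xb Hne) as Ht. rewrite (vnorm_vsub_sym n xb x) in Hfar.
  set (t := vnorm (vsub x xb)) in *.
  pose proof (pos_INR n) as Hn.
  exists (fun i => / t * coord (vsub x xb) i).
  assert (E : forall i, coord xb i + t * (/ t * coord (vsub x xb) i) = coord x i).
  { intros i. rewrite coord_vsub. field. lra. }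
  split; [|split].
  - rewrite sum_sq_scale. replace (sum_sq n (coord (vsub x xb))) with (t ^ 2); [field; lra|].
    apply pow2_sqrt, sum_sq_nonneg.
  - rewrite (of_fun_ext n _ (coord x)); [now rewrite of_fun_coord|]. intros i _. apply E.
  - replace (fun i => coord xb i + t * (/ t * coord (vsub x xb) i)) with (coord x)
      by (apply functional_extensionality; intros i; now rewrite E).
    destruct (germ_dichotomy (approach n X (eps / (INR n + 1)) (coord x)
      (fun i => - (/ t * coord (vsub x xb) i)))) as [H|H]; [|exfalso|exact H].
    + apply (definable_approach n X _ (fun i _ => coord x i)
        (fun i _ => - (/ t * coord (vsub x xb) i)) (fun e => e 0%nat) HX).
      * intros i. definable.
      * intros i. definable.
      * definable.
    + destruct (tangent_of_approach _ _ _ _ _ HX H) as (v & Hv & Hclose).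
      apply Hfar. exists v. split; [exact Hv|].
      apply Rle_lt_trans with (INR n * (eps / (INR n + 1))).
      * apply norm_le; [left; apply Rdiv_lt_0_compat; lra|]. intros i Hi.
        specialize (Hclose i Hi). rewrite coord_vsub, coord_vscale.
        rewrite coord_vsub in Hclose |- *.
        replace (/ t * (coord xb i - coord x i)) with (- (/ t * (coord x i - coord xb i)))
          by ring. exact Hclose.
      * apply Rlt_le_trans with ((INR n + 1) * (eps / (INR n + 1))); [|right; field; lra].
        apply Rmult_lt_compat_r; [apply Rdiv_lt_0_compat; lra|lra].
Qed.

Theorem theorem8p5 (n : nat) (X : vec n -> Prop) (xb : vec n) :
  semialgebraic X -> X xb -> nearly_radial X xb.
Proof.
  intros Hsa _ eps Heps.
  pose proof (semialgebraic_definable n X Hsa) as HX.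
  set (eps' := eps / (INR n + 1)).
  assert (Heps' : 0 < eps').
  { apply Rdiv_lt_0_compat; [exact Heps|]. pose proof (pos_INR n). lra. }
  (* Here [t] is the distance to [xb]: bad points occur at all small distances or at none, and in
     the latter case [d] serves as the required radius. *)
  destruct (germ_dichotomy (fun t => exists w, bad n X (coord xb) eps' t w)) as [H|H].
  - apply (definable_exists_point n (fun w e => bad n X (coord xb) eps' (e 0%nat) w)).
    + intros w w' e. apply bad_ext.
    + exact (definable_rename _ (fun i => match i with O => (n + 0)%nat | S j => j end)
        (definable_bad n X (coord xb) eps' HX)).
  - elim (not_eventually_bad n X (coord xb) eps' HX Heps' H).
  - destruct H as (d & Hd & K). exists d. split; [exact Hd|].
    intros x Hx Hne Hlt. apply NNPP. intros Hfar.
    apply (K (vnorm (vsub x xb))); [now apply vnorm_vsub_pos|exact Hlt|].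
    now apply bad_of_far.
Qed.
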